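(* Let $(X,d)$ be a compact metric space and $f:X\to X$ a continuous map. Assume that $f$ is sequentially saturated and that $\hat{\mathfrak C}^0(f,X)\neq\emptyset$. Then for every subset $D\subseteq\hat{\mathfrak C}^0(f,X)$ and every $\Phi\in\mathfrak C^0(f,X)$, $$P_f\Big(\bigcap_{\Psi\in D}I(\Psi,f),\Phi\Big)=P_f(\Phi).$$
   Context: Asymptotically additive sequences. A sequence $\Phi=(\phi_n)_{n\ge1}$ of continuous functions $\phi_n:X\to\mathbb R$ is asymptotically additive if for each $\delta>0$ there is a continuous $\psi_\delta:X\to\mathbb R$ with $\limsup_{n\to\infty}\frac1n\|\phi_n-S_n\psi_\delta\|<\delta$, where $\|\cdot\|$ is the supremum norm and $S_n\psi_\delta(x)=\sum_{i=0}^{n-1}\psi_\delta(f^i(x))$. $\mathfrak C^0(f,X)$ is the set of all asymptotically additive sequences. For $\Phi=(\phi_n)_n\in\mathfrak C^0(f,X)$, the $\Phi$-irregular set is $I(\Phi,f)=\{x\in X:\lim_{n\to\infty}\frac{\phi_n(x)}{n}\text{ does not exist}\}$, and $\hat{\mathfrak C}^0(f,X)=\{\Phi\in\mathfrak C^0(f,X):I(\Phi,f)\neq\emptyset\}$. Measures. $\mathcal M_f(X)$ is the space of $f$-invariant Borel probability measures on $X$ with the weak$^*$ topology; $h_\mu(f)$ is the measure-theoretic entropy of $\mu\in\mathcal M_f(X)$; $\Phi^*(\mu):=\lim_{n\to\infty}\int\frac{\phi_n}{n}\,d\mu$ (this limit always exists). $\mathcal M_xf$ is the set of weak$^*$ limit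 points of the sequence $\mathcal E_n(x)=\frac1n\sum_{j=0}^{n-1}\delta_{f^j(x)}$. Topological pressure. Let $B_n(x,\varepsilon)=\{y\in X: d(f^i(x),f^i(y))<\varepsilon,\ 0\le i\le n-1\}$. For $Z\subseteq X$, $\alpha\in\mathbb R$, $\varepsilon>0$, $N\in\mathbb N$, put $$M(Z,\alpha,\varepsilon,N,\Phi)=\inf_\Gamma\sum_{B_n(x,\varepsilon)\in\Gamma}\exp\Big(-\alpha n+\sup_{y\in B_n(x,\varepsilon)}\phi_n(y)\Big),$$ where the infimum is over all finite or countable covers $\Gamma$ of $Z$ by sets of the form $B_n(x,\varepsilon)$ (with $n$ and $x\in X$ allowed to vary within $\Gamma$) such that every $n$ occurring satisfies $n\ge N$. Put $m(Z,\alpha,\varepsilon,\Phi)=\lim_{N\to\infty}M(Z,\alpha,\varepsilon,N,\Phi)$, $P_f(Z,\Phi,\varepsilon)=\inf\{\alpha:m(Z,\alpha,\varepsilon,\Phi)=0\}=\sup\{\alpha:m(Z,\alpha,\varepsilon,\Phi)=\infty\}$, and $P_f(Z,\Phi)=\lim_{\varepsilon\to0}P_f(Z,\Phi,\varepsilon)$. Write $P_f(\Phi):=P_f(X,\Phi)$. Sequentially saturated. $f$ is sequentially saturated if for every $\Phi\in\mathfrak C^0(f,X)$ and every non-empty compact connected set $K\subseteq\mathcal M_f(X)$ one has $P_f(G_K,\Phi)=\inf\{h_\mu(f)+\Phi^*(\mu):\mu\in K\}$, where $G_K=\{x\in X:\mathcal M_xf=K\}$. *)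

(* Defs.v *)
From HB Require Import structures.
From mathcomp Require Import all_boot all_order all_algebra.
From mathcomp Require Import all_classical all_reals all_analysis.

Set Implicit Arguments.
Unset Strict Implicit.
Unset Printing Implicit Defensive.

Import Order.TTheory GRing.Theory Num.Theory.
Import numFieldNormedType.Exports.

Local Open Scope classical_set_scope.
Local Open Scope ring_scope.

(* The base point is only there because [measurableType] requires one; no
   definition below depends on it. *)
#[short(type="pointedMetricType")]
HB.structure Definition PointedMetric (R : realType) :=
  { X of Metric R X & Pointed X }.

(* Throughout, a sequence (phi_n)_{n >= 1} is a function [nat -> X -> R] whose
   value at index 0 plays no role. *)

Section AdditiveSequences.
Variables (R : realType) (X : pointedMetricType R) (f : X -> X).

Definition birkhoff_sum (psi : X -> R) (n : nat) (x : X) : R :=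
  \sum_(i < n) psi (iter i f x).

Definition sup_norm (g : X -> R) : \bar R :=
  ereal_sup [set `|g x|%:E | x in [set: X]].

Definition asymptotically_additive (Phi : nat -> X -> R) : Prop :=
  (forall n, (0 < n)%N -> continuous (Phi n)) /\
  forall delta : R, 0 < delta ->
    exists psi : X -> R, continuous psi /\
      (limn_esup (fun n => (n%:R^-1)%:E *
         sup_norm (fun x => Phi n x - birkhoff_sum psi n x)%R) < delta%:E)%E.

Definition irregular_set (Phi : nat -> X -> R) : set X :=
  [set x | ~ cvg ((fun n => Phi n x / n%:R) @ \oo)].

Definition irregular_sequence (Phi : nat -> X -> R) : Prop :=
  asymptotically_additive Phi /\ irregular_set Phi !=set0.

End AdditiveSequences.

Section Measures.
Variables (R : realType) (X : pointedMetricType R) (f : X -> X).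

Definition borel := g_sigma_algebraType (@open X).

Definition weak_eval (mu : probability borel R) :
    {ptws (continuousType X R) -> R} :=
  fun phi => \int[mu]_x phi x.

(* Borel probability measures with the weak* topology: the coarsest one making
   mu |-> \int phi dmu continuous for every continuous phi. *)
Definition borel_prob := initial_topology weak_eval.

Definition invariant_measures : set borel_prob :=
  [set mu | forall A : set borel, measurable A ->
     (mu : probability borel R) (f @^-1` A) =
     (mu : probability borel R) A].

(* A [probability] also carries arbitrary values on non-measurable sets, so a
   Borel measure corresponds to a class of the relation "equal on Borel sets"
   and a set of Borel measures to a set closed under this relation. *)
Definition borel_closed (K : set borel_prob) : Prop :=
  forall mu nu : borel_prob,
    (forall A : set borel, measurable A ->
       (mu : probability borel R) A = (nu : probability borel R) A) ->
    K mu -> K nu.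

(* [empirical x n] is \mathcal E_{n+1}(x). *)
Section Empirical.
Variables (x : X) (n : nat).

Definition empirical : set borel -> \bar R :=
  mscale (n.+1%:R^-1)%:nng
    (msum (fun j => @dirac _ borel (iter j f x) R) n.+1).

HB.instance Definition _ := Measure.on empirical.

Let empirical_setT : empirical [set: borel] = 1%E.
Proof.
rewrite /empirical /mscale /= /msum (eq_bigr (fun=> 1%E)); last first.
  by move=> i _; exact: diracT.
by rewrite sumEFin -EFinM sumr_const card_ord mulVf.
Qed.

HB.instance Definition _ :=
  Measure_isProbability.Build _ _ _ empirical empirical_setT.

Definition empirical_prob : borel_prob := (empirical : probability borel R).

End Empirical.

Definition limit_measures (x : X) : set borel_prob :=
  cluster (empirical_prob x @ \oo).

Definition saturated_set (K : set borel_prob) : set X :=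
  [set x | limit_measures x = K].

(* A finite partition is given by its labelling [X -> T]; empty atoms are
   harmless since [0 * ln 0 = 0]. *)
Definition partition_entropy (mu : probability borel R) (T : finType)
    (xi : X -> T) : R :=
  - \sum_(t : T) (let p := fine (mu (xi @^-1` [set t])) in p * ln p).

(* The labelling of the join of the f^{-i} xi, 0 <= i < n. *)
Definition partition_join (T : finType) (xi : X -> T) (n : nat) (x : X) :
    {ffun 'I_n -> T} :=
  [ffun i : 'I_n => xi (iter i f x)].

Definition entropy_of_partition (mu : probability borel R) (T : finType)
    (xi : X -> T) : \bar R :=
  limn (fun n => (partition_entropy mu (partition_join xi n) / n%:R)%:E).

Definition measure_entropy (mu : probability borel R) : \bar R :=
  ereal_sup [set h | exists (k : nat) (xi : X -> 'I_k),
    (forall i, measurable (xi @^-1` [set i] : set borel)) /\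
    h = entropy_of_partition mu xi].

Definition mean_value (Phi : nat -> X -> R) (mu : probability borel R) : R :=
  limn (fun n => \int[mu]_x (Phi n x / n%:R)).

End Measures.

Section Pressure.
Variables (R : realType) (X : pointedMetricType R) (f : X -> X).

Definition bowen_ball (n : nat) (x : X) (eps : R) : set X :=
  [set y | forall i, (i < n)%N -> mdist (iter i f x) (iter i f y) < eps].

(* The ball B_n(x, eps) is recorded by the pair (x, n). *)
Definition bowen_cover (Z : set X) (eps : R) (N : nat)
    (G : set (X * nat)) : Prop :=
  [/\ countable G,
      forall q, G q -> (0 < q.2)%N && (N <= q.2)%N &
      Z `<=` \bigcup_(q in G) bowen_ball q.2 q.1 eps].

Definition pressure_sum (Phi : nat -> X -> R) (alpha eps : R)
    (G : set (X * nat)) : \bar R :=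
  \esum_(q in G)
    (expR (- alpha * q.2%:R + sup (Phi q.2 @` bowen_ball q.2 q.1 eps)))%:E.

Definition pressure_pre (Z : set X) (alpha eps : R) (N : nat)
    (Phi : nat -> X -> R) : \bar R :=
  ereal_inf [set pressure_sum Phi alpha eps G | G in bowen_cover Z eps N].

Definition pressure_outer (Z : set X) (alpha eps : R) (Phi : nat -> X -> R) :
    \bar R :=
  limn (fun N => pressure_pre Z alpha eps N Phi).

Definition pressure_at (Z : set X) (Phi : nat -> X -> R) (eps : R) : \bar R :=
  ereal_inf [set alpha%:E | alpha in
    [set alpha : R | pressure_outer Z alpha eps Phi = 0%E]].

Definition pressure (Z : set X) (Phi : nat -> X -> R) : \bar R :=
  lim (pressure_at Z Phi eps @[eps --> 0^'+]).

End Pressure.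

Definition sequentially_saturated (R : realType) (X : pointedMetricType R)
    (f : X -> X) : Prop :=
  forall (Phi : nat -> X -> R) (K : set (borel_prob X)),
    asymptotically_additive f Phi ->
    borel_closed K -> K `<=` @invariant_measures R X f ->
    K !=set0 -> compact K -> connected K ->
    pressure f (saturated_set f K) Phi =
    ereal_inf [set (measure_entropy f mu + (mean_value Phi mu)%:E)%E
              | mu in K].

(* Main.v *)
Require Import Defs.
From HB Require Import structures.
From mathcomp Require Import all_boot all_order all_algebra.
From mathcomp Require Import all_classical all_reals all_analysis.
From mathcomp Require Import measurable_realfun ring lra zify.
Import Order.TTheory GRing.Theory Num.Theory.
Import numFieldNormedType.Exports.
Set Implicit Arguments.
Unset Strict Implicit.
Unset Printing Implicit Defensive.
Local Open Scope classical_set_scope.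
Local Open Scope ring_scope.

(** Write h for entropy and Psi^*(mu) for the mean value of Psi at mu. The
    pressure of a subset is at most that of X, so let c < P_f(Phi); it has to be
    shown that c is at most the pressure of the intersection of the irregular
    sets.

    By the variational principle there is an invariant measure mu with
    h_mu(f) + Phi^*(mu) > c (variational_bound). For 0 < th <= 1 let K be the set
    of the measures (1 - th) mu + th nu with nu invariant (homothety). It is
    compact and convex, hence connected. Entropy is concave and nonnegative and
    Phi^* is affine and bounded, so h + Phi^* >= c on K as soon as th is small,
    and saturation gives P_f(G_K, Phi) >= c.

    On the other hand G_K is contained in I(Psi, f) for every Psi in D. Indeed
    Psi has an irregular point, and the limits of Psi_n(x) / n along two
    different ultrafilters are the mean values of Psi at two different invariant
    measures (irregular_mean_value); so Psi^* is not constant on the invariant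
    measures, hence not on K. Since all measures of K are limit measures of a
    point of G_K, the sequence Psi_n(x) / n has two cluster values there
    (saturated_mean_value). One and the same K serves all the sequences Psi,
    which is why D may be arbitrarily large.

    Two general facts carry this argument. The first is the weak compactness of
    the set of probability measures (ultra_weak_limit): the setwise limit of
    measures along an ultrafilter is a finitely additive content, its values on
    closed sets generate an outer measure (fin_additive_measure), and the
    resulting measure agrees with the content on sets with negligible boundary
    (continuity_set_eq). This yields the existence of invariant measures, the
    compactness of the set they form, and the convergence of the entropies of
    partitions with negligible boundaries. The second is the variational
    principle, proved with Misiurewicz's measures (weighted_empirical) and with
    inequalities between entropies of finite probability vectors that come from
    the Gibbs inequality (gibbs). *)

(** * Entropy of finite probability vectors *)

Section Shannon.
Variable R : realType.

Definition shannon (T : finType) (p : T -> R) : R := - \sum_t p t * ln (p t).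

Definition law (E T : finType) (w : E -> R) (g : E -> T) (t : T) : R :=
  \sum_(e | g e == t) w e.

Lemma gibbs_pointwise (p q : R) : 0 <= p -> 0 <= q -> (q = 0 -> p = 0) ->
  p * ln q - p * ln p <= q - p.
Proof.
move=> p0 q0 qp; have [->|pN0] := eqVneq p 0; first by rewrite !mul0r !subr0.
have pgt : 0 < p by rewrite lt_neqAle eq_sym pN0.
have qgt : 0 < q.
  by rewrite lt_neqAle q0 andbT; apply/eqP => /esym /qp /eqP; rewrite (negbTE pN0).
rewrite -mulrBr -ln_div ?posrE //.
have -> : q - p = p * (q / p - 1) by field.
rewrite ler_pM2l //.
have := @le_ln1Dx R (q / p - 1); rewrite [1 + _]addrC subrK; apply.
by rewrite ltrBrDr addNr divr_gt0.
Qed.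

(** Nonnegativity of relative entropy. Concavity, subadditivity, upper
    semicontinuity and the bound by the logarithm of the number of labels are
    obtained from it by a suitable choice of q. *)
Lemma gibbs (T : finType) (p q : T -> R) : (forall t, 0 <= p t) ->
  (forall t, 0 <= q t) -> (forall t, q t = 0 -> p t = 0) ->
  \sum_t q t <= \sum_t p t -> shannon p <= - \sum_t p t * ln (q t).
Proof.
move=> p0 q0 qp qple; rewrite lerN2 -subr_le0 -sumrB.
apply: (@le_trans _ _ (\sum_t (q t - p t))).
  by apply: ler_sum => t _; apply: gibbs_pointwise => //; exact: qp.
by rewrite sumrB subr_le0.
Qed.

Lemma shannon_ge0 (T : finType) (p : T -> R) : (forall t, 0 <= p t <= 1) ->
  0 <= shannon p.
Proof.
move=> p01; rewrite oppr_ge0; apply: sumr_le0 => t _.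
have /andP[p0 p1] := p01 t; apply: mulr_ge0_le0 => //; exact: ln_le0.
Qed.

Lemma card_gt0_sum1 (T : finType) (p : T -> R) : \sum_t p t = 1 -> (0 < #|T|)%N.
Proof.
move=> p1; rewrite lt0n; apply/eqP => /card0_eq T0.
by move: p1; rewrite big_pred0 // => /eqP; rewrite eq_sym oner_eq0.
Qed.

Lemma shannon_le_ln_card (T : finType) (p : T -> R) : (forall t, 0 <= p t) ->
  \sum_t p t = 1 -> shannon p <= ln #|T|%:R.
Proof.
move=> p0 p1; have T0 := card_gt0_sum1 p1.
have T0' : 0 < #|T|%:R :> R by rewrite ltr0n.
apply: le_trans (@gibbs _ p (fun=> #|T|%:R^-1) p0 _ _ _) _.
- by move=> _; rewrite invr_ge0 ler0n.
- by move=> t /eqP; rewrite invr_eq0 (gt_eqF T0').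
- by rewrite p1 sumr_const -[_ *+ _]mulr_natr mulVf ?gt_eqF.
- by rewrite -mulr_suml p1 mul1r lnV ?posrE // opprK.
Qed.

(** Concavity: the Gibbs inequality with the averaged vector as q. *)
Lemma shannon_mixture (I T : finType) (c : I -> R) (p : I -> T -> R) :
  (forall i, 0 <= c i) -> (forall i t, 0 <= p i t) ->
  (forall i j, \sum_t p i t = \sum_t p j t) -> \sum_i c i = 1 ->
  \sum_i c i * shannon (p i) <= shannon (fun t => \sum_i c i * p i t).
Proof.
move=> c0 p0 psum csum; set q := fun t => \sum_i c i * p i t.
have qE : forall i, \sum_t q t = \sum_t p i t.
  move=> i; rewrite exchange_big /=.
  under eq_bigr => j _ do rewrite -mulr_sumr (psum j i).
  by rewrite -mulr_suml csum mul1r.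
have -> : shannon q = \sum_i c i * - \sum_t p i t * ln (q t).
  rewrite /shannon; under [RHS]eq_bigr do rewrite mulrN mulr_sumr.
  rewrite sumrN exchange_big /=; congr (- _); apply: eq_bigr => t _.
  by rewrite {1}/q mulr_suml; apply: eq_bigr => i _; rewrite mulrA.
apply: ler_sum => i _; have [->|ci0] := eqVneq (c i) 0; first by rewrite !mul0r.
apply: ler_wpM2l => //; apply: gibbs => //.
- by move=> t; apply: sumr_ge0 => j _; rewrite mulr_ge0.
- move=> t /eqP; rewrite psumr_eq0; last by move=> j _; rewrite mulr_ge0.
  by move=> /allP/(_ i); rewrite mem_index_enum mulf_eq0 (negbTE ci0) => /(_ isT) /eqP.
- by rewrite (qE i).
Qed.

Section Law.
Variables (E : finType) (w : E -> R).
Hypotheses (w0 : forall e, 0 <= w e) (w1 : \sum_e w e = 1).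

Lemma law_ge0 (T : finType) (g : E -> T) t : 0 <= law w g t.
Proof. by apply: sumr_ge0. Qed.

Lemma law_sum (T : finType) (g : E -> T) (F : T -> R) :
  \sum_t law w g t * F t = \sum_e w e * F (g e).
Proof.
under eq_bigr do rewrite mulr_suml.
rewrite (exchange_big_dep predT) //=; apply: eq_bigr => e _.
by rewrite (big_pred1 (g e)).
Qed.

Lemma law_sum1 (T : finType) (g : E -> T) : \sum_t law w g t = 1.
Proof.
rewrite -w1; under eq_bigr do rewrite -[law _ _ _]mulr1.
by rewrite (law_sum g (fun=> 1)); under eq_bigr do rewrite mulr1.
Qed.

Lemma law_le1 (T : finType) (g : E -> T) t : law w g t <= 1.
Proof. by rewrite -(law_sum1 g) (bigD1 t) //= lerDl sumr_ge0 // => *; exact: law_ge0. Qed.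

Lemma le_law (T : finType) (g : E -> T) e : w e <= law w g (g e).
Proof. by rewrite /law (bigD1 e) //= lerDl sumr_ge0. Qed.

(** Entropy of a label as an average over the underlying points, the form in
    which labels on the same space can be compared pointwise. *)
Lemma shannon_lawE (T : finType) (g : E -> T) :
  shannon (law w g) = - \sum_e w e * ln (law w g (g e)).
Proof. by rewrite /shannon law_sum. Qed.

Lemma shannon_law_inj (T : finType) (g : E -> T) : injective g ->
  shannon (law w g) = shannon w.
Proof.
move=> gi; rewrite shannon_lawE; congr (- _); apply: eq_bigr => e _.
by rewrite /law (big_pred1 e) // => e'; rewrite (inj_eq gi).
Qed.

(** Subadditivity: the law of the pair has relative entropy at least zero with
    respect to the product of its marginals, and a label that is a function of
    the pair has smaller entropy than the pair. *)
Lemma shannon_join (T S Z : finType) (g : E -> T) (g' : E -> S) (z : E -> Z)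
  (h : T -> S -> Z) : (forall e, z e = h (g e) (g' e)) ->
  shannon (law w z) <= shannon (law w g) + shannon (law w g').
Proof.
move=> zE; pose gg e := (g e, g' e).
apply: (@le_trans _ _ (shannon (law w gg))).
  rewrite !shannon_lawE lerN2; apply: ler_sum => e _.
  have [->|we0] := eqVneq (w e) 0; first by rewrite !mul0r.
  have wgt : 0 < w e by rewrite lt_neqAle eq_sym we0 w0.
  apply: ler_wpM2l => //; rewrite ler_ln ?posrE; last 2 first.
  - exact: lt_le_trans wgt (le_law gg e).
  - exact: lt_le_trans wgt (le_law z e).
  rewrite /law big_mkcond [leRHS]big_mkcond; apply: ler_sum => e' _.
  case: ifP => [/eqP[ge ge']|_]; last by case: ifP.
  by rewrite !zE ge ge' eqxx.
have -> : shannon (law w g) + shannon (law w g') =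
    - \sum_(ts : T * S) law w gg ts * ln (law w g ts.1 * law w g' ts.2).
  rewrite (law_sum gg (fun ts => ln (law w g ts.1 * law w g' ts.2))) /=.
  rewrite !shannon_lawE -opprD -big_split /=; congr (- _); apply: eq_bigr => e _.
  have [->|we0] := eqVneq (w e) 0; first by rewrite !mul0r addr0.
  have wgt : 0 < w e by rewrite lt_neqAle eq_sym we0 w0.
  rewrite lnM ?posrE; last 2 first.
  - exact: lt_le_trans wgt (le_law g e).
  - exact: lt_le_trans wgt (le_law g' e).
  by rewrite mulrDr.
apply: gibbs.
- by move=> ts; exact: law_ge0.
- by move=> ts; rewrite mulr_ge0 ?law_ge0.
- move=> [t s] /= /eqP; rewrite mulf_eq0 => /orP[] /eqP l0; apply/eqP;
    rewrite eq_le law_ge0 andbT -l0 /law big_mkcond [leRHS]big_mkcond /=;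
    apply: ler_sum => e _; rewrite xpair_eqE;
    by do ?[case: (_ == _)] => /=.
- rewrite law_sum1 -(pair_big predT predT (fun t s => law w g t * law w g' s)) /=.
  under eq_bigr do rewrite -mulr_sumr law_sum1 mulr1.
  by rewrite law_sum1.
Qed.

End Law.

Lemma sum_blocks (F : nat -> R) (q M : nat) :
  \sum_(r < M) \sum_(j < q) F (j + r * q)%N = \sum_(m < M * q) F m.
Proof.
elim: M => [|M IH]; first by rewrite mul0n !big_ord0.
rewrite big_ord_recr /= IH mulSn addnC -!(big_mkord xpredT F).
rewrite [RHS](big_cat_nat (n := (M * q)%N)) ?leq_addr //=.
congr (_ + _); rewrite -{2}[(M * q)%N]add0n big_addn addKn big_mkord.
by apply: eq_bigr.
Qed.

(** Cutting [0, n) into blocks of length q in the q possible ways and averaging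
    replaces the entropy of n consecutive letters by that of q letters; the
    leftover at both ends has at most 2q letters. *)
Lemma block_averaging (a : nat -> nat -> R) (C : R) (q n : nat) :
  (forall m l1 l2, (m + l1 + l2 <= n)%N ->
     a m (l1 + l2)%N <= a m l1 + a (m + l1)%N l2) ->
  (forall m l, (m + l <= n)%N -> a m l <= l%:R * C) ->
  (forall m l, 0 <= a m l) -> 0 <= C -> (0 < q)%N ->
  q%:R * a 0%N n <= \sum_(m < n) a m q + 2 * q%:R ^+ 2 * C.
Proof.
move=> asub aC a0 C0 q0; set M := (n %/ q)%N; set s := (n %% q)%N.
have nE : n = (M * q + s)%N by exact: divn_eq.
have sq : (s < q)%N by rewrite ltn_mod.
have blocks : forall N m, (m + N * q <= n)%N ->
    a m (N * q)%N <= \sum_(r < N) a (m + r * q)%N q.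
  elim=> [|N IH] m mN.
    by rewrite mul0n big_ord0; have := aC m 0%N; rewrite mul0r addn0; apply; lia.
  rewrite big_ord_recr /= mulSnr; apply: le_trans (asub _ _ _ _) _; first by lia.
  by rewrite lerD2r; apply: IH; lia.
have one : forall j, (j < q)%N ->
    a 0%N n <= \sum_(r < M.-1) a (j + r * q)%N q + 2 * q%:R * C.
  move=> j jq; have [M0|M0] := posnP M.
    rewrite M0 big_ord0 add0r; apply: le_trans (aC _ _ _) _ => //.
    apply: ler_wpM2r => //; rewrite -natrM ler_nat; lia.
  (* One block less than fits: the last piece then has a length between 0 and 2q,
     whatever the offset j. *)
  have nE' : n = (j + (M.-1 * q + (q + s - j)))%N.
    by rewrite {1}nE -{1}(prednK M0) mulSn; lia.
  rewrite {1}nE'; apply: le_trans (asub _ _ _ _) _; first by rewrite -nE'.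
  have /(le_trans _) := lexx (2 * q%:R * C).
  have h1 : a 0%N j <= j%:R * C by apply: aC; lia.
  have h2 : a (0 + j)%N (M.-1 * q + (q + s - j))%N <=
     \sum_(r < M.-1) a (j + r * q)%N q + (q + s - j)%:R * C.
    apply: le_trans (asub _ _ _ _) _; first by lia.
    apply: lerD; first by apply: blocks; lia.
    by apply: aC; lia.
  have h3 : (j%:R + (q + s - j)%:R) * C <= 2 * q%:R * C.
    by apply: ler_wpM2r => //; rewrite -natrD -natrM ler_nat; lia.
  by move=> _; rewrite mulrDl in h3; lra.
have -> : q%:R * a 0%N n = \sum_(j < q) a 0%N n.
  by rewrite sumr_const card_ord mulr_natl.
apply: (@le_trans _ _ (\sum_(j < q)
    (\sum_(r < M.-1) a (j + r * q)%N q + 2 * q%:R * C))).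
  by apply: ler_sum => j _; exact: one.
rewrite big_split /= exchange_big /= (sum_blocks (fun m => a m q)).
rewrite sumr_const card_ord; apply: lerD; last first.
  by rewrite -[_ *+ q]mulr_natr; rewrite le_eqVlt; apply/orP; left; apply/eqP; ring.
rewrite -!(big_mkord xpredT (fun m => a m q)).
have le1 : (M.-1 * q <= n)%N by rewrite nE (leq_trans _ (leq_addr _ _)) // leq_mul2r leq_pred orbT.
by rewrite [leRHS](big_cat_nat (n := (M.-1 * q)%N)) //= lerDl sumr_ge0.
Qed.

End Shannon.

(** * From finitely additive contents to Borel measures *)

Section BorelSets.
Variables (R : realType) (X : pointedMetricType R).

Lemma open_borel (A : set X) : open A -> measurable (A : set (borel X)).
Proof. by move=> oA; apply: sub_sigma_algebra. Qed.

Lemma closed_borel (A : set X) : closed A -> measurable (A : set (borel X)).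
Proof.
by move=> cA; rewrite -[A]setCK; apply: measurableC; apply: open_borel; exact: closed_openC.
Qed.

End BorelSets.

Section FromContentToMeasure.
Variables (R : realType) (X : pointedMetricType R).
Hypothesis hX : compact [set: X].

(** Limits of measures along an ultrafilter are only finitely additive. Values
    on sets that are not Borel are left unconstrained. *)
Record fin_additive (m : set X -> R) : Prop := FinAdditive {
  fa_ge0 : forall A : set (borel X), measurable A -> 0 <= m A ;
  fa_setT : m setT = 1 ;
  fa_setU : forall A B : set (borel X), measurable A -> measurable B ->
    A `&` B = set0 -> m (A `|` B) = m A + m B }.

Variable m : set X -> R.
Hypothesis hm : fin_additive m.

Lemma fa_set0 : m set0 = 0.
Proof.
have := fa_setU hm measurable0 measurable0 (setI0 _).
by rewrite setU0 => /eqP; rewrite -subr_eq0 opprD addNKr oppr_eq0 => /eqP.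
Qed.

Lemma fa_setC (A : set (borel X)) : measurable A -> m (~` A) = 1 - m A.
Proof.
move=> mA; rewrite -(fa_setT hm) -(setUv A) (fa_setU hm) //; last 2 first.
- exact: measurableC.
- exact: setICr.
by rewrite addrAC subrr add0r.
Qed.

Lemma fa_le (A B : set (borel X)) : measurable A -> measurable B -> A `<=` B ->
  m A <= m B.
Proof.
move=> mA mB AB; have -> : B = A `|` (B `\` A) by rewrite setDUK.
by rewrite fa_setU ?setDIK // ?lerDl ?(fa_ge0 hm) //; exact: measurableD.
Qed.

Lemma fa_setU_le (A B : set (borel X)) : measurable A -> measurable B ->
  m (A `|` B) <= m A + m B.
Proof.
move=> mA mB; have -> : A `|` B = A `|` (B `\` A).
  by apply/seteqP; split=> x /=; have [] := pselect (A x); tauto.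
rewrite fa_setU ?setDIK //; last exact: measurableD.
by rewrite lerD2l; apply: fa_le => //; exact: measurableD.
Qed.

Local Open Scope ereal_scope.

(** Countable additivity is lost in m itself but is recovered by keeping only
    the values of m on closed, hence compact, sets. *)
Definition open_content (U : set X) : \bar R :=
  ereal_sup [set (m C)%:E | C in [set C | closed C /\ C `<=` U]].

Definition outer_content (A : set X) : \bar R :=
  ereal_inf [set open_content U | U in [set U | open U /\ A `<=` U]].

Lemma open_content_ge (U C : set X) : closed C -> C `<=` U ->
  (m C)%:E <= open_content U.
Proof. by move=> cC CU; apply: ereal_sup_ubound; exists C. Qed.

Lemma open_content_ge0 U : 0 <= open_content U.
Proof. by have := @open_content_ge U set0 closed0; rewrite fa_set0; apply. Qed.

Lemma open_content_le U V : U `<=` V -> open_content U <= open_content V.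
Proof.
move=> UV; apply: ge_ereal_sup => _ [C [cC CU] <-].
by apply: open_content_ge => //; exact: subset_trans UV.
Qed.

(** A closed subset of U `|` V is the union of a closed subset of U and one of
    V, by normality. *)
Lemma open_content_setU U V : open U -> open V ->
  open_content (U `|` V) <= open_content U + open_content V.
Proof.
move=> oU oV; apply: ge_ereal_sup => _ [C [cC CUV] <-].
have nX : normal_space X by exact: (@pseudometric_normal R).
have [|||/= U1 [V1 [oU1 oV1 sU1 sV1 UV0]]] :=
    (iffLR (@normal_openP R X) nX (C `\` V) (C `\` U)) _ _ _.
- by apply: closedI => //; exact: open_closedC.
- by apply: closedI => //; exact: open_closedC.
- by apply/seteqP; split=> x //= [[Cx nV] [_ nU]]; case: (CUV x Cx).
have c1 : closed (C `\` V1) by apply: closedI => //; exact: open_closedC.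
have c2 : closed (C `\` U1) by apply: closedI => //; exact: open_closedC.
have s1 : C `\` V1 `<=` U.
  by move=> x [Cx nV1]; apply: contrapT => nU; apply: nV1; apply: sV1.
have s2 : C `\` U1 `<=` V.
  by move=> x [Cx nU1]; apply: contrapT => nV; apply: nU1; apply: sU1.
apply: le_trans (leeD (open_content_ge c1 s1) (open_content_ge c2 s2)).
rewrite -EFinD lee_fin.
apply: le_trans (fa_setU_le (closed_borel c1) (closed_borel c2)).
apply: fa_le; [exact: closed_borel|exact: closed_borel (closedU c1 c2)|].
move=> x Cx; have [Vx|nVx] := pselect (V1 x); [right|by left].
by split=> // Ux; have : (U1 `&` V1) x by []; rewrite UV0.
Qed.

Lemma open_content_bigsetU (U : nat -> set X) (N : nat) : (forall i, open (U i)) ->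
  open_content (\big[setU/set0]_(i < N) U i) <= \sum_(i < N) open_content (U i).
Proof.
move=> oU; elim: N => [|N IH].
  rewrite !big_ord0; apply: ge_ereal_sup => _ [C [_ +] <-]; rewrite subset0 => ->.
  by rewrite fa_set0.
rewrite !big_ord_recr /=; apply: le_trans (open_content_setU _ _) _ => //.
  by rewrite -(bigcup_mkord N U); apply: bigcup_open => i _.
by rewrite leeD2r.
Qed.

(** Compactness is what turns finite into countable subadditivity. *)
Lemma open_content_bigcup (U : nat -> set X) : (forall i, open (U i)) ->
  open_content (\bigcup_i U i) <= \sum_(i <oo) open_content (U i).
Proof.
move=> oU; apply: ge_ereal_sup => _ [C [cC CU] <-].
have : compact C by exact: (subclosed_compact cC hX).
rewrite compact_cover => /(_ _ setT U (fun i _ => oU i) CU)[D' _ CD'].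
pose N := (\max_(i <- finmap.enum_fset D') i.+1)%N.
have CN : C `<=` \big[setU/set0]_(i < N) U i.
  move=> x /CD' [i /= iD Ux]; rewrite -bigcup_mkord; exists i => //=.
  exact: (@leq_bigmax_seq _ _ xpredT (fun i => i.+1)).
apply: le_trans (open_content_ge cC CN) _.
apply: le_trans (open_content_bigsetU _ oU) _.
rewrite -(big_mkord xpredT (fun i => open_content (U i))).
by apply: nneseries_lim_ge => i _ _; exact: open_content_ge0.
Qed.

Lemma outer_content_open U : open U -> outer_content U = open_content U.
Proof.
move=> oU; apply/eqP; rewrite eq_le; apply/andP; split.
  by apply: ereal_inf_lbound; exists U => //; split.
by apply: le_ereal_inf_tmp => _ [V [oV UV] <-]; exact: open_content_le.
Qed.

Lemma outer_content_ge0 A : 0 <= outer_content A.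
Proof. by apply: le_ereal_inf_tmp => _ [V _ <-]; exact: open_content_ge0. Qed.

Lemma outer_content_closed C : closed C -> (m C)%:E <= outer_content C.
Proof. by move=> cC; apply: le_ereal_inf_tmp => _ [V [_ CV] <-]; exact: open_content_ge. Qed.

Lemma outer_content_setT : outer_content setT = 1.
Proof.
rewrite outer_content_open; last exact: openT.
apply/eqP; rewrite eq_le; apply/andP; split; last first.
  by rewrite -(fa_setT hm); apply: open_content_ge => //; exact: closedT.
apply: ge_ereal_sup => _ [C [cC _] <-]; rewrite -(fa_setT hm) lee_fin.
by apply: fa_le => //; exact: closed_borel.
Qed.

Lemma outer_content_le A B : A `<=` B -> outer_content A <= outer_content B.
Proof.
move=> AB; apply: ereal_inf_le_tmp => _ [V [oV BV] <-]; exists V => //; split => //.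
exact: subset_trans BV.
Qed.

Lemma outer_content_fin A : outer_content A \is a fin_num.
Proof.
rewrite ge0_fin_numE ?outer_content_ge0 //.
apply: (le_lt_trans (outer_content_le (@subsetT _ A))).
by rewrite outer_content_setT ltry.
Qed.

Lemma outer_content_sigma_subadditive : sigma_subadditive outer_content.
Proof.
move=> F; apply/lee_addgt0Pr => e e0.
have hU n : exists U, [/\ open U, F n `<=` U &
    open_content U <= outer_content (F n) + (e / (2 ^ n.+1)%:R)%:E].
  have en : (0 < e / (2 ^ n.+1)%:R)%R by rewrite divr_gt0 // ltr0n expn_gt0.
  have [_ [U [oU FU] <-] lt] := lb_ereal_inf_adherent en (outer_content_fin (F n)).
  by exists U; split => //; exact: ltW.
have [U HU] := choice hU.
apply: le_trans (epsilon_trick xpredT (fun n => outer_content_ge0 (F n)) (ltW e0)).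
apply: (@le_trans _ _ (outer_content (\bigcup_i U i))).
  by apply: outer_content_le; apply: subset_bigcup => i _; have [] := HU i.
have oU i : open (U i) by have [] := HU i.
rewrite outer_content_open; last by apply: bigcup_open => i _.
apply: le_trans (open_content_bigcup oU) _.
apply: lee_nneseries => [i _ _|i _]; first exact: open_content_ge0.
by have [] := HU i.
Qed.

Let outer_content0 : outer_content set0 = 0.
Proof.
rewrite outer_content_open; last exact: open0.
apply/eqP; rewrite eq_le open_content_ge0 andbT.
by apply: ge_ereal_sup => _ [C [_ +] <-]; rewrite subset0 => ->; rewrite fa_set0.
Qed.

(** The outer measure induced by m makes open sets measurable: inside an open
    set, a closed part of V and a closed set disjoint from it add up. The
    resulting measure dominates m on closed sets; nothing better can be
    expected, since mass of m may move to the boundary of a set. *)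
Lemma fin_additive_measure :
  exists mu : probability (borel X) R,
    forall C, closed C -> (m C <= fine (mu C))%R.
Proof.
pose oc : {outer_measure set X -> \bar R} := HB.pack_for (outer_measure R X)
  outer_content (isOuterMeasure.Build R X outer_content outer_content0
  outer_content_ge0 outer_content_le outer_content_sigma_subadditive).
have cara_open V : open V -> oc.-caratheodory V.
  move=> oV; apply: le_caratheodory_measurable => A.
  apply: le_ereal_inf_tmp => _ [U [oU AU] <-].
  have oUV : open (U `&` V) by exact: openI.
  have le1 : oc (A `&` V) <= open_content (U `&` V).
    by rewrite -outer_content_open //; apply: outer_content_le; exact: setSI.
  have fin2 : oc (A `&` ~` V) \is a fin_num by exact: outer_content_fin.
  apply: le_trans (leeD2r _ le1) _; rewrite -leeBrDr //.
  apply: ge_ereal_sup => _ [C [cC CUV] <-]; rewrite leeBrDr //.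
  have oW : open (U `\` C) by apply: openI => //; exact: closed_openC.
  have le2 : oc (A `&` ~` V) <= open_content (U `\` C).
    rewrite -outer_content_open //; apply: outer_content_le => x [Ax nV].
    by split; [exact: AU|move=> /CUV[]].
  apply: le_trans (leeD2l _ le2) _; rewrite addeC -leeBrDr //.
  apply: ge_ereal_sup => _ [D [cD DUC] <-]; rewrite leeBrDr // -EFinD.
  rewrite -(fa_setU hm); last 3 first.
  - exact: closed_borel.
  - exact: closed_borel.
  - by apply/seteqP; split=> x //= [/DUC[]].
  apply: open_content_ge; first exact: closedU.
  by move=> x [/DUC[]//|/CUV[]].
have cara_borel (A : set (borel X)) : measurable A -> oc.-cara.-measurable A.
  apply: smallest_sub; last by move=> V oV; exact: cara_open.
  exact: (@sigma_algebra_measurable _ (caratheodory_type oc)).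
pose mu0 : set (borel X) -> \bar R := outer_content.
have mu0_sadd : semi_sigma_additive mu0.
  move=> F mF tF mU; apply: (@caratheodory_measure_sigma_additive R X oc) => //.
  - by move=> i; apply: cara_borel.
  - exact: cara_borel.
pose mu1 : {measure set (borel X) -> \bar R} := HB.pack_for
  {measure set (borel X) -> \bar R} mu0
  (isMeasure.Build _ _ _ mu0 outer_content0 outer_content_ge0 mu0_sadd).
pose mu : probability (borel X) R := HB.pack_for (probability (borel X) R)
  (Measure.sort mu1) (Measure_isProbability.Build _ _ _ mu1 outer_content_setT).
exists mu => C cC; rewrite -lee_fin fineK; last exact: outer_content_fin.
exact: outer_content_closed.
Qed.

End FromContentToMeasure.

(** * Sets with negligible boundary *)

Section ContinuitySets.
Variables (R : realType) (X : pointedMetricType R).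
Implicit Types (mu : probability (borel X) R).

Lemma mdist_continuous (x : X) : continuous (mdist x : X -> R).
Proof.
move=> y; apply/cvgrPdist_lt => e e0; near=> z.
have yz : mdist y z < e.
  near: z; have := nbhsx_ballx y _ e0; by rewrite ballEmdist.
have := metric_triangle x y z; have := metric_triangle x z y.
rewrite (metric_sym z y) ltr_norml => h1 h2; lra.
Unshelve. all: by end_near. Qed.

Lemma open_mdist_lt (x : X) (r : R) : open [set y : X | mdist x y < r].
Proof.
apply: (@open_comp _ _ (mdist x : X -> R) [set t | t < r]); last exact: open_lt.
by move=> y _; exact: mdist_continuous.
Qed.

Lemma closed_mdist_le (x : X) (r : R) : closed [set y : X | mdist x y <= r].
Proof.
apply: (@closed_comp _ _ (mdist x : X -> R) [set t | t <= r]); last exact: closed_le.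
by move=> y _; exact: mdist_continuous.
Qed.

(** The boundary of A is negligible: it lies in C `\` V. Certifying this by V and
    C instead of the interior and closure of A makes the closure properties
    immediate. *)
Definition continuity_set mu (A : set X) : Prop :=
  measurable (A : set (borel X)) /\
  exists V C : set X, [/\ open V, closed C, V `<=` A, A `<=` C &
    mu (C `\` V) = 0%E].

Lemma continuity_setT mu : continuity_set mu setT.
Proof.
split; first exact: measurableT.
by exists setT, setT; split; rewrite ?setDv ?measure0 //; first [exact: openT|exact: closedT].
Qed.

Lemma continuity_setC mu A : continuity_set mu A -> continuity_set mu (~` A).
Proof.
move=> [mA [V [C [oO cC OA AC COA]]]]; split; first exact: measurableC.
exists (~` C), (~` V); split.
- exact: closed_openC.
- exact: open_closedC.
- by apply: subsetC.
- by apply: subsetC.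
- by rewrite setDE setCK setIC -setDE.
Qed.

Lemma measure_eq0_sub mu (A B : set (borel X)) : measurable A -> measurable B ->
  A `<=` B -> mu B = 0%E -> mu A = 0%E.
Proof. by move=> mA mB AB B0; apply: (subset_measure0 mA mB AB). Qed.

Lemma continuity_setI mu A B : continuity_set mu A -> continuity_set mu B ->
  continuity_set mu (A `&` B).
Proof.
move=> [mA [V [C [oO cC OA AC COA]]]] [mB [V' [C' [oO' cC' OB BC COB]]]].
split; first exact: measurableI.
exists (V `&` V'), (C `&` C'); split.
- exact: openI.
- exact: closedI.
- exact: setISS.
- exact: setISS.
have mD (P Q : set X) : closed P -> open Q ->
    measurable ((P `\` Q) : set (borel X)).
  by move=> cP oQ; apply: measurableD; [exact: closed_borel|exact: open_borel].
apply: (@measure_eq0_sub mu _ ((C `\` V) `|` (C' `\` V'))).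
- by apply: mD; [exact: closedI|exact: openI].
- by apply: measurableU; exact: mD.
- move=> x [[Cx C'x] nO]; have [Ox|nOx] := pselect (V x); [right|left] => //.
  by split => // V'x; apply: nO.
- apply/eqP; rewrite -measure_le0; apply: le_trans (measureU2 _ _ _) _.
  + exact: mD.
  + exact: mD.
  + by rewrite [X in (X + _)%E]COA [X in (_ + X)%E]COB adde0.
Qed.

Lemma measurable_preimage (f : X -> X) (A : set (borel X)) : continuous f ->
  measurable A -> measurable (f @^-1` A : set (borel X)).
Proof.
move=> cf; move: A; apply: smallest_sub; last first.
  by move=> U oU; apply: open_borel; apply: open_comp => // x _; exact: cf.
split.
- by rewrite /= preimage_set0; exact: measurable0.
- by move=> A /= mA; rewrite setTD; apply: measurableC.
- by move=> F mF; rewrite /= preimage_bigcup; apply: bigcupT_measurable.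
Qed.

Lemma continuity_set_preimage (f : X -> X) mu A : continuous f ->
  invariant_measures f mu -> continuity_set mu A ->
  continuity_set mu (f @^-1` A).
Proof.
move=> cf imu [mA [V [C [oO cC OA AC COA]]]].
split; first exact: measurable_preimage.
exists (f @^-1` V), (f @^-1` C); split.
- by apply: open_comp => // x _; exact: cf.
- by apply: closed_comp => // x _; exact: cf.
- exact: preimage_subset.
- exact: preimage_subset.
- rewrite -COA -(imu (C `\` V)) //; apply: measurableD; first exact: closed_borel.
  exact: open_borel.
Qed.

Lemma probability_fin_additive mu : fin_additive (fun A : set X => fine (mu A)).
Proof.
split.
- by move=> A mA; apply: fine_ge0.
- by rewrite probability_setT.
- move=> A B mA mB AB; rewrite measureU // fineD //; exact: fin_num_measure.
Qed.

Lemma content_open_ge (m : set X -> R) mu (V : set X) : fin_additive m ->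
  (forall C, closed C -> m C <= fine (mu C)) -> open V -> fine (mu V) <= m V.
Proof.
move=> hm hC oV; have mV := open_borel oV.
have := hC _ (open_closedC oV).
rewrite (fa_setC hm mV) (fa_setC (probability_fin_additive mu) mV); lra.
Qed.

(** The portmanteau argument: an inequality on closed sets becomes an equality
    on sets with negligible boundary. *)
Lemma continuity_set_eq (m : set X -> R) mu A : fin_additive m ->
  (forall C, closed C -> m C <= fine (mu C)) -> continuity_set mu A ->
  m A = fine (mu A).
Proof.
move=> hm hC [mA [V [C [oO cC OA AC COA]]]].
have fmu := probability_fin_additive mu.
have mO := open_borel oO; have mC := closed_borel cC.
have mDC : measurable (C `\` V : set (borel X)) by exact: measurableD.
have OC : V `<=` C by exact: subset_trans AC.
have muCO : fine (mu C) = fine (mu V).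
  have := fa_setU fmu mO mDC (setDIK _ _); rewrite setDUK // COA /= addr0; exact.
apply/eqP; rewrite eq_le; apply/andP; split.
  apply: le_trans (fa_le hm mA mC AC) _; apply: le_trans (hC _ cC) _.
  by rewrite muCO; exact: (fa_le fmu mO mA OA).
apply: le_trans (fa_le fmu mA mC AC) _; rewrite muCO.
exact: le_trans (content_open_ge hm hC oO) (fa_le hm mO mA OA).
Qed.

(** Distinct radii around a point give disjoint spheres, and the measures of the
    open and closed balls of radius r enclose a rational as soon as the sphere
    of radius r is charged; hence only countably many spheres are charged. *)
Lemma continuity_ball mu (x : X) (a b : R) : a < b ->
  exists2 r, a < r < b & continuity_set mu [set y | mdist x y < r].
Proof.
move=> ab; pose fmu (A : set X) := fine (mu A).
have hmu : fin_additive fmu := probability_fin_additive mu.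
pose O r := [set y : X | mdist x y < r]; pose C r := [set y : X | mdist x y <= r].
have mO r : measurable (O r : set (borel X)) by apply: open_borel; exact: open_mdist_lt.
have mC r : measurable (C r : set (borel X)) by apply: closed_borel; exact: closed_mdist_le.
have OC r : O r `<=` C r by move=> y; exact: ltW.
have [r rab r0] : exists2 r, a < r < b & mu (C r `\` O r) = 0%E; last first.
  exists r => //; split; first exact: mO.
  exists (O r), (C r); split; [exact: open_mdist_lt|exact: closed_mdist_le|by []|exact: OC|by []].
apply: contrapT => no.
have charged r : r \in `]a, b[ -> fmu (O r) < fmu (C r).
  rewrite in_itv /= => rab; rewrite lt_neqAle (fa_le hmu (mO r) (mC r) (@OC r)) andbT.
  apply/eqP => e; apply: no; exists r => //.
  have mD : measurable (C r `\` O r : set (borel X)) by exact: measurableD.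
  have := fa_setU hmu (mO r) mD (setDIK _ _); rewrite setDUK // -e => /eqP.
  rewrite -subr_eq0 opprD addNKr oppr_eq0 /fmu => /eqP e0.
  by rewrite -[LHS]fineK ?e0 //; exact: fin_num_measure.
have hq r : exists q : rat, r \in `]a, b[ ->
    fmu (O r) < ratr q /\ ratr q < fmu (C r).
  have [/charged/rat_in_itvoo[q]|_] := boolP (r \in `]a, b[); last by exists 0.
  by rewrite in_itv /= => /andP[]; exists q.
have [q Hq] := choice hq.
have cnt : countable (`]a, b[%classic : set R).
  apply/(countable_injP) => /=.
  exists (pickle \o q) => r s; rewrite !inE /= => rI sI /(pcan_inj pickleK) e.
  have [ri1 ri2] := Hq r rI; have [si1 si2] := Hq s sI.
  have aux u v : u < v -> fmu (C u) <= fmu (O v).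
    move=> uv; apply: (fa_le hmu) => // y /= h; exact: le_lt_trans uv.
  case: (ltgtP r s) => // /aux h.
  - by have := lt_trans ri2 (le_lt_trans h si1); rewrite e ltxx.
  - by have := lt_trans si2 (le_lt_trans h ri1); rewrite e ltxx.
have := countable_lebesgue_measure0 cnt; rewrite lebesgue_measure_itv /= lte_fin ab.
by move/eqP; rewrite -EFinB eqe subr_eq0 (gt_eqF ab).
Qed.

(** Finite partitions are given by labellings, as in the definition of the
    entropy of a measure. *)
Definition fine_labelling mu (eps : R) (k : nat) (xi : X -> 'I_k) : Prop :=
  (forall i, continuity_set mu (xi @^-1` [set i])) /\
  forall x y, xi x = xi y -> mdist x y < eps.

(** The first ball of a list that contains y is determined by finitely many
    intersections and complements of balls. *)
Lemma continuity_find mu (s : seq X) (B : X -> X -> bool) :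
  (forall c, continuity_set mu [set y | B c y]) ->
  forall i, continuity_set mu [set y | find (B^~ y) s = i].
Proof.
move=> cB; elim: s => [|c s IH] i /=.
  case: i => [|i].
    rewrite (_ : [set _ | _] = setT); first exact: continuity_setT.
    by apply/seteqP; split.
  rewrite (_ : [set _ | _] = ~` setT); last by rewrite setCT; apply/seteqP; split.
  by apply: continuity_setC; exact: continuity_setT.
case: i => [|i].
  rewrite (_ : [set _ | _] = [set y | B c y]) //.
  by apply/seteqP; split=> y /=; case: ifP.
rewrite (_ : [set _ | _] = ~` [set y | B c y] `&` [set y | find (B^~ y) s = i]).
  by apply: continuity_setI => //; exact: continuity_setC.
by apply/seteqP; split=> y /=; case: ifP => h; [|move=> [->]| |move=> [_ ->]] => //; case.
Qed.

(** Cover X by finitely many balls with negligible spheres and radii between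
    eps / 4 and eps / 2, and label a point by the first ball that contains it. *)
Lemma fine_labelling_ex mu (eps : R) : compact [set: X] -> 0 < eps ->
  exists (k : nat) (xi : X -> 'I_k), fine_labelling mu eps xi.
Proof.
move=> hX e0; have e42 : eps / 4 < eps / 2 by lra.
have hr x : exists r : R, eps / 4 < r < eps / 2 /\
    continuity_set mu [set y | mdist x y < r].
  by have [r] := continuity_ball mu x e42; exists r.
have [r Hr] := choice hr.
have := hX; rewrite compact_cover.
move=> /(_ X setT (fun x => [set y | mdist x y < r x]) (fun x _ => open_mdist_lt x _)).
move=> [y _|D' _ cov].
  exists y => //=; rewrite mdistxx; have [/andP[h _] _] := Hr y; lra.
pose s := finmap.enum_fset D'; pose B c y := mdist c y < r c.
pose g y := find (B^~ y) s.
have gs y : (g y < size s)%N.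
  by rewrite -has_find; have [c cD yc] := cov y I; apply/hasP; exists c.
exists (size s), (fun y => Ordinal (gs y)); split.
- move=> i; rewrite (_ : _ @^-1` _ = [set y | g y = i]).
    apply: (@continuity_find mu s B) => c; exact: (Hr c).2.
  by apply/seteqP; split=> y /=; [move=> <-|move=> e; apply/val_inj].
- move=> x y [gxy].
  pose c := nth point s (g x).
  have hx : B c x by apply: (@nth_find _ point (B^~ x)); rewrite has_find; exact: gs.
  have hy : B c y.
    by rewrite /c gxy; apply: (@nth_find _ point (B^~ y)); rewrite has_find; exact: gs.
  have := metric_triangle x c y; rewrite (metric_sym x c).
  move: hx hy; rewrite /B; have [/andP[_ h] _] := Hr c; lra.
Qed.

Lemma continuous_compact_mdist (phi : X -> R) (eta : R) : compact [set: X] ->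
  continuous phi -> 0 < eta -> exists2 eps, 0 < eps &
  forall x y, mdist x y < eps -> `|phi x - phi y| < eta.
Proof.
move=> hX cphi e0; have e2 : 0 < eta / 2 by lra.
have hd x : exists d : R, 0 < d /\ forall y, mdist x y < 2 * d -> `|phi x - phi y| < eta / 2.
  have /cvgrPdist_lt/(_ _ e2) := cphi x; rewrite -nbhs_ballE => -[d /= d0 H].
  exists (d / 2); split; first lra.
  by move=> y xy; apply: H; rewrite ballEmdist /=; lra.
have [d Hd] := choice hd.
have := hX; rewrite compact_cover.
move=> /(_ X setT (fun x => [set y | mdist x y < d x]) (fun x _ => open_mdist_lt x _)).
move=> [y _|D' _ cov].
  by exists y => //=; rewrite mdistxx; have [] := Hd y.
pose s := finmap.enum_fset D'.
have [eps eps0 He] : exists2 eps : R, 0 < eps & forall c, c \in s -> eps <= d c.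
  elim: (s) => [|c s' [e ee0 IH]]; first by exists 1.
  exists (Num.min e (d c)); first by rewrite lt_min ee0; have [] := Hd c.
  move=> c'; rewrite inE => /orP[/eqP ->|/IH h]; rewrite ge_min ?lexx ?orbT //.
  by rewrite h.
exists eps => // x y xy; have [c cD xc] := cov x I.
have [_ Hc] := Hd c; have [dc _] := Hd c; have := He c cD => ec.
have h1 : `|phi c - phi x| < eta / 2 by apply: Hc; move: xc => /=; lra.
have h2 : `|phi c - phi y| < eta / 2.
  by apply: Hc; have := metric_triangle c x y; move: xc => /=; lra.
have := ler_distD (phi c) (phi x) (phi y); rewrite (distrC (phi x) (phi c)); lra.
Qed.

End ContinuitySets.

(** * Limits along ultrafilters *)

Section Ultra.

Lemma ultra_fmap (I T : Type) (U : set_system I) (u : I -> T) :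
  UltraFilter U -> UltraFilter (u @ U).
Proof.
move=> UU; split; first exact: fmap_proper_filter.
move=> G GF sUG; rewrite predeqE => A; split; last exact: sUG.
move=> GA; have [//|UnA] := in_ultra_setVsetC (u @^-1` A) UU.
have GnA : G (~` A) by apply: sUG.
have : G (A `&` ~` A) by exact: filterI.
by rewrite setICr => /filter_not_empty.
Qed.

Lemma ultra_bounded_cvg (R : realType) (I : Type) (U : set_system I) (u : I -> R)
  (B : R) : UltraFilter U -> (forall i, `|u i| <= B) -> cvg (u @ U).
Proof.
move=> UU uB; have UuU := ultra_fmap u UU.
have := @segment_compact R (- B) B; rewrite compact_ultra => /(_ _ UuU)[].
  by apply: (@filterE _ U) => i /=; rewrite in_itv /= -ler_norml.
by move=> l [_ /= ul]; apply/cvg_ex; exists l.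
Qed.

(** If u does not converge to l along F, the complement of some neighbourhood of
    l has a preimage that meets every set of F, and an ultrafilter finer than F
    contains it. This replaces the extraction of subsequences. *)
Lemma cvg_ultra (R : realType) (I : Type) (F : set_system I) (u : I -> R) (l : R) :
  Filter F ->
  (forall U : set_system I, UltraFilter U -> F `<=` U -> u @ U --> l) -> u @ F --> l.
Proof.
move=> FF H; apply/cvgrPdist_lt => e e0; apply: contrapT => nF.
pose A := [set i | `|l - u i| < e].
have nFA : ~ F A by [].
have GP : ProperFilter (filter_from F (fun B => B `&` ~` A)).
  apply: filter_from_proper.
    apply: filter_from_filter; first by exists setT; exact: filterT.
    move=> B C FB FC; exists (B `&` C); first exact: filterI.
    by move=> i [[Bi Ci] nA].
  move=> B FB; apply: contrapT => no; apply: nFA; apply: filterS FB => i Bi.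
  by apply: contrapT => nA; apply: no; exists i.
have [U [UU GU]] := ultraFilterLemma GP.
have UnA : U (~` A) by apply: GU; exists setT; [exact: filterT|rewrite setTI].
have /cvgrPdist_lt/(_ _ e0) UA : u @ U --> l.
  by apply: H => // B FB; apply: GU; exists B => // i [].
have : U (A `&` ~` A) by exact: filterI.
by rewrite setICr => /filter_not_empty.
Qed.

Lemma ptws_cvg (I : Type) (F : set_system I) (T : Type) (V : topologicalType)
    (g : I -> {ptws T -> V}) (l : {ptws T -> V}) : Filter F ->
  (forall t, g i t @[i --> F] --> l t) -> g @ F --> l.
Proof.
move=> FF H; apply/cvg_sup => t A [B [[C oC <-] Cl CA]].
have /H : nbhs (l t) C by exact: open_nbhs_nbhs.
by rewrite !nbhs_simpl /= => FC; apply: (filterS _ FC) => i; exact: CA.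
Qed.

End Ultra.

(** * Integrals of continuous functions *)

Section Integrals.
Variables (R : realType) (X : pointedMetricType R).
Hypothesis hX : compact [set: X].
Implicit Types (mu : probability (borel X) R) (phi : X -> R).

Lemma continuous_measurable phi : continuous phi ->
  measurable_fun [set: borel X] (phi : borel X -> R).
Proof.
move=> cphi; apply: (measurability _ (RGenOInfty.measurableE R)) => _ [_ [a ->] <-].
rewrite setTI; apply: open_borel; apply: open_comp => [x _|]; first exact: cphi.
by rewrite set_itvE; exact: open_gt.
Qed.

Lemma continuous_bounded phi : continuous phi -> exists B, forall x, `|phi x| <= B.
Proof.
move=> cphi; have /compact_bounded[M [_ HM]] :=
  continuous_compact (continuous_subspaceT cphi) hX.
by exists (M + 1) => x; apply: HM; [rewrite ltrDl|exists x].
Qed.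

Lemma bounded_integrable mu (g : borel X -> R) (B : R) :
  measurable_fun [set: borel X] g -> (forall x, `|g x| <= B) ->
  mu.-integrable [set: borel X] (EFin \o g).
Proof.
move=> mg gB; apply: measurable_bounded_integrable => //.
  by apply: (@le_lt_trans _ _ 1%E); [exact: probability_le1|exact: ltry].
exists B; split; first exact: num_real.
by move=> M BM x _ /=; apply: le_trans (gB x) (ltW BM).
Qed.

Lemma continuous_integrable mu phi : continuous phi ->
  mu.-integrable [set: borel X] (EFin \o phi).
Proof.
move=> cphi; have [B HB] := continuous_bounded cphi.
by apply: (@bounded_integrable mu _ (B)) => //; exact: continuous_measurable.
Qed.

Lemma Rintegral_cst_probability mu (c : R) : \int[mu]_x c = c.
Proof. by rewrite Rintegral_cst // [X in _ * fine X](probability_setT mu) mulr1. Qed.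

Lemma Rintegral_step mu (k : nat) (xi : X -> 'I_k) (c : 'I_k -> R) :
  (forall i, measurable (xi @^-1` [set i] : set (borel X))) ->
  mu.-integrable [set: borel X] (EFin \o (c \o xi)) /\
  \int[mu]_x c (xi x) = \sum_i c i * fine (mu (xi @^-1` [set i])).
Proof.
move=> mxi; pose g i (x : borel X) : R := c i * \1_(xi @^-1` [set i]) x.
have ind1 (A : set (borel X)) x : `|\1_A x : R| <= 1.
  by rewrite indicE; case: (_ \in _); rewrite ?normr1 ?normr0.
have mg i : measurable_fun [set: borel X] (g i).
  by apply: measurable_funM => //; exact: measurable_indic.
have ig i : mu.-integrable [set: borel X] (EFin \o g i).
  apply: (@bounded_integrable mu _ (`|c i|)) => // x.
  by rewrite /g normrM ler_piMr.
have intg i : \int[mu]_x g i x = c i * fine (mu (xi @^-1` [set i])).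
  rewrite RintegralZl //.
    by congr (_ * _); rewrite /Rintegral integral_indic // setIT.
  apply: (@bounded_integrable mu _ (1)); first exact: measurable_indic.
  exact: ind1.
have sumg (s : seq 'I_k) :
    mu.-integrable [set: borel X] (EFin \o (fun x => \sum_(i <- s) g i x)) /\
    \int[mu]_x (\sum_(i <- s) g i x) = \sum_(i <- s) \int[mu]_x g i x.
  elim: s => [|i s [IH1 IH2]].
    rewrite big_nil; under eq_fun do rewrite big_nil.
    by split; [exact: finite_measure_integrable_cst|rewrite Rintegral_cst_probability].
  rewrite big_cons; under eq_fun do rewrite big_cons.
  split; last by rewrite RintegralD // IH2.
  by have := integrableD measurableT (ig i) IH1; apply: eq_integrable.
have cE : (fun x => c (xi x)) = (fun x => \sum_i g i x).
  apply/funext => x; rewrite (bigD1 (xi x)) //= big1 ?addr0 => [|i ix].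
    by rewrite /g indicE mem_set // mulr1.
  rewrite /g indicE memNset ?mulr0 //=.
  by move=> /= xii; rewrite xii eqxx in ix.
have [h1 h2] := sumg (index_enum 'I_k).
split; first by rewrite (_ : c \o xi = fun x => \sum_i g i x).
transitivity (\int[mu]_x \sum_i g i x); first by congr (Rintegral _ _ _).
by rewrite h2; apply: eq_bigr => i _; exact: intg.
Qed.

Lemma Rintegral_le_dist mu (g h : borel X -> R) (eta : R) :
  mu.-integrable [set: borel X] (EFin \o g) ->
  mu.-integrable [set: borel X] (EFin \o h) ->
  (forall x, `|g x - h x| <= eta) -> `|\int[mu]_x g x - \int[mu]_x h x| <= eta.
Proof.
move=> ig ih gh; rewrite -RintegralB //.
have igh : mu.-integrable [set: borel X] (EFin \o (fun x => g x - h x)).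
  by have := integrableB measurableT ig ih; apply: eq_integrable.
apply: le_trans (le_normr_Rintegral measurableT igh) _.
rewrite -[leRHS](Rintegral_cst_probability mu); apply: le_Rintegral => //.
  exact: (integrable_norm igh).
exact: finite_measure_integrable_cst.
Qed.

(** Integrals of continuous functions are controlled by the measures of finitely
    many cells, so statements about integrals reduce to statements about
    measures of continuity sets. *)
Lemma Rintegral_labelled mu phi (k : nat) (xi : X -> 'I_k) (c : 'I_k -> R)
  (eta : R) : continuous phi ->
  (forall i, measurable (xi @^-1` [set i] : set (borel X))) ->
  (forall x, `|phi x - c (xi x)| <= eta) ->
  `|\int[mu]_x phi x - \sum_i c i * fine (mu (xi @^-1` [set i]))| <= eta.
Proof.
move=> cphi mxi H; have [ixi <-] := Rintegral_step mu c mxi.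
by apply: Rintegral_le_dist => //; exact: continuous_integrable.
Qed.

Lemma step_approximation mu phi (e : R) : continuous phi -> 0 < e ->
  exists (k : nat) (xi : X -> 'I_k) (c : 'I_k -> R),
    (forall i, continuity_set mu (xi @^-1` [set i])) /\
    forall x, `|phi x - c (xi x)| <= e.
Proof.
move=> cphi e0; have [eps eps0 Heps] := continuous_compact_mdist hX cphi e0.
have [k [xi [cxi dxi]]] := fine_labelling_ex mu hX eps0.
exists k, xi, (fun i => phi (get [set x | xi x = i])); split => // x.
apply/ltW/Heps/dxi; have : [set y | xi y = xi x] !=set0 by exists x.
by move/getPex.
Qed.

Lemma Rintegral_bound mu phi (B : R) : continuous phi ->
  (forall x, `|phi x| <= B) -> `|\int[mu]_x phi x| <= B.
Proof.
move=> cphi HB; rewrite -[X in `|X|]subr0 -(Rintegral_cst_probability mu 0).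
apply: Rintegral_le_dist; first exact: continuous_integrable.
  exact: finite_measure_integrable_cst.
by move=> x; rewrite subr0.
Qed.

End Integrals.

(** * Weak limits of probability measures *)

Section WeakLimits.
Variables (R : realType) (X : pointedMetricType R) (f : X -> X).
Hypotheses (hX : compact [set: X]) (hf : continuous f).

Lemma cvg_borel_prob (I : Type) (F : set_system I) (nu : I -> borel_prob X)
    (mu : borel_prob X) : Filter F ->
  (forall phi : X -> R, continuous phi ->
     (\int[nu i]_x phi x) @[i --> F] --> \int[mu]_x phi x) ->
  nu i @[i --> F] --> mu.
Proof.
move=> FF H.
have key : (fun i => @weak_eval R X (nu i)) @ F --> @weak_eval R X mu.
  by apply: ptws_cvg => phi; exact: (H phi (@cts_fun _ _ phi)).
move=> A /= [_ [[B oB <-] Bmu BA]].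
have : nbhs (@weak_eval R X mu : {ptws _ -> _}) B by exact: open_nbhs_nbhs.
by move/key => FB; apply: (@filterS _ F _ _ _ _ FB) => i; exact: BA.
Qed.

Lemma weak_eval_continuous (phi : X -> R) : continuous phi ->
  continuous (fun mu : borel_prob X => \int[mu]_x phi x).
Proof.
move=> cphi mu.
have c := @initial_continuous _ _ (@weak_eval R X) mu.
have p := @proj_continuous (continuousType X R) (fun=> R) (mkcts cphi) (weak_eval mu).
exact: (continuous_comp c p).
Qed.

(** The measure mu is squeezed by the content m: it is at most m on open sets and
    at least m on closed sets. Inserting F `<=` W `<=` C `<=` V with F, C closed
    and W, V open gives mu F <= m W <= m C = m (f @^-1` C) <= mu (f @^-1` V),
    and likewise with the two preimages exchanged; letting F increase to V
    compares mu and its image on open sets. *)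
Lemma invariant_of_content (m : set X -> R) (mu : probability (borel X) R) :
  fin_additive m -> (forall C, closed C -> m C <= fine (mu C)) ->
  (forall A : set (borel X), measurable A -> m (f @^-1` A) = m A) ->
  invariant_measures f mu.
Proof.
move=> hm hC mf.
have hmu := probability_fin_additive mu.
have openge (V : set X) : open V -> fine (mu V) <= m V by exact: content_open_ge.
have nX : normal_space X by exact: (@pseudometric_normal R).
have between (F V : set X) : closed F -> open V -> F `<=` V -> exists W C,
    [/\ open W, closed C, F `<=` W, W `<=` C & C `<=` V].
  move=> cF oV FV.
  have [|||W [W' [oW oW' FW VW WW]]] :=
      (iffLR (@normal_openP R X) nX F (~` V)) _ _ _ => //.
  - exact: open_closedC.
  - by apply/seteqP; split=> x // [/FV].
  exists W, (~` W'); split => //; first exact: open_closedC.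
  - by move=> x Wx W'x; have : (W `&` W') x by []; rewrite WW.
  - by move=> x W'x; apply: contrapT => nV; apply: W'x; apply: VW.
have mfun : measurable_fun [set: borel X] (f : borel X -> borel X).
  by move=> _ A mA; rewrite setTI; exact: measurable_preimage.
have meas1 (F V : set X) : closed F -> open V -> F `<=` V ->
    fine (mu F) <= fine (mu (f @^-1` V)) /\ fine (mu (f @^-1` F)) <= fine (mu V).
  move=> cF oV FV; have [W [C [oW cC FW WC CV]]] := between F V cF oV FV.
  have oP (A : set X) : open A -> open (f @^-1` A).
    by move=> oA; apply: open_comp => // x _; exact: hf.
  have cP (A : set X) : closed A -> closed (f @^-1` A).
    by move=> cA; apply: closed_comp => // x _; exact: hf.
  have bo (A : set X) : open A -> measurable (A : set (borel X)) by exact: open_borel.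
  have bc (A : set X) : closed A -> measurable (A : set (borel X)) by exact: closed_borel.
  split.
    apply: le_trans (fa_le hmu (bc _ cF) (bo _ oW) FW) _.
    apply: le_trans (openge _ oW) _.
    apply: le_trans (fa_le hm (bo _ oW) (bc _ cC) WC) _.
    rewrite -(mf C); last exact: bc.
    apply: le_trans (hC _ (cP _ cC)) _.
    by apply: (fa_le hmu); [exact: (bc _ (cP _ cC))|exact: (bo _ (oP _ oV))|exact: preimage_subset].
  apply: le_trans (fa_le hmu (bc _ (cP _ cF)) (bo _ (oP _ oW)) (preimage_subset FW)) _.
  apply: le_trans (openge _ (oP _ oW)) _.
  rewrite mf; last exact: bo.
  apply: le_trans (fa_le hm (bo _ oW) (bc _ cC) WC) _.
  apply: le_trans (hC _ cC) _.
  by apply: (fa_le hmu); [exact: bc|exact: bo|].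
have openE (V : set (borel X)) : open (V : set X) -> mu (f @^-1` V) = mu V.
  move=> oV.
  (* The points at distance at least 1 / (n + 1) from the complement of V. *)
  pose F n := [set x : X | forall y, mdist x y < n.+1%:R^-1 -> (V : set X) y].
  have cF n : closed (F n).
    rewrite -[F n]setCK; apply: open_closedC.
    rewrite (_ : ~` F n = \bigcup_(y in ~` (V : set X)) [set x | mdist y x < n.+1%:R^-1]).
      by apply: bigcup_open => y _; exact: open_mdist_lt.
    apply/seteqP; split=> x /=.
      by move/existsNP => [y /not_implyP[xy nV]]; exists y => //=; rewrite metric_sym.
    by move=> [y nV /= xy] Fx; apply: nV; apply: Fx; rewrite metric_sym.
  have FV n : F n `<=` V by move=> x; apply; rewrite mdistxx invr_gt0.
  have ndF : nondecreasing_seq (F : (set (borel X))^nat).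
    move=> a b ab; apply/subsetPset => x Fx y xy; apply: Fx.
    by apply: lt_le_trans xy _; rewrite lef_pV2 ?posrE // ler_nat.
  have UF : \bigcup_n F n = V.
    apply/seteqP; split=> [x [n _]|x Vx]; first exact: FV.
    have := open_nbhs_nbhs (conj oV Vx); rewrite -nbhs_ballE => -[e /= e0 eV].
    have [n ne] : exists n : nat, n.+1%:R^-1 < e.
      exists (Num.trunc e^-1); rewrite -[ltRHS]invrK ltf_pV2 ?posrE ?invr_gt0 //.
      exact: truncnS_gt.
    exists n => // y xy; apply: eV; rewrite ballEmdist /=; exact: lt_trans ne.
  have mF n : measurable (F n : set (borel X)) by exact: closed_borel.
  have mfF n : measurable (f @^-1` F n : set (borel X)) by exact: measurable_preimage.
  have mV : measurable V by exact: open_borel.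
  have mfV : measurable (f @^-1` V : set (borel X)) by exact: measurable_preimage.
  have c1 : mu (F n) @[n --> \oo] --> mu V.
    by rewrite -UF; apply: nondecreasing_cvg_mu => //; rewrite UF.
  have c2 : mu (f @^-1` F n) @[n --> \oo] --> mu (f @^-1` V).
    rewrite -UF preimage_bigcup; apply: nondecreasing_cvg_mu => //.
      by rewrite -preimage_bigcup UF.
    move=> a b ab; apply/subsetPset; apply: preimage_subset.
    by apply/subsetPset; exact: ndF.
  apply/eqP; rewrite eq_le; apply/andP; split.
  - apply: (cvge_to_le c2); near=> n; rewrite -[leLHS]fineK ?fin_num_measure //.
    rewrite -[leRHS]fineK ?fin_num_measure // lee_fin.
    by have [] := meas1 _ _ (cF n) oV (FV n).
  - apply: (cvge_to_le c1); near=> n; rewrite -[leLHS]fineK ?fin_num_measure //.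
    rewrite -[leRHS]fineK ?fin_num_measure // lee_fin.
    by have [] := meas1 _ _ (cF n) oV (FV n).
move=> A mA.
pose pf : {measure set (borel X) -> \bar R} := pushforward mu (f : borel X -> borel X).
change (pf mfun A = mu A).
apply: (@measure_unique _ R (borel X) (@open X) (fun=> setT) _ _ _ _ (pf mfun) mu) => //.
- by move=> U V; exact: openI.
- by move=> _; exact: openT.
- by rewrite bigcup_const.
- move=> _; change (mu (f @^-1` setT) < +oo)%E.
  by rewrite ltey_eq fin_num_measure //; exact: measurable_preimage.
Unshelve. all: by end_near. Qed.

(** Weak compactness of the probability measures: the setwise limit along an
    ultrafilter is a content, which is turned into a measure. The two agree on
    continuity sets, hence integrals of continuous functions converge, and the
    measures of the cells of a good partition converge as well. *)
Lemma ultra_weak_limit (I : Type) (U : set_system I)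
    (nu : I -> probability (borel X) R) : UltraFilter U ->
  exists mu : probability (borel X) R,
  [/\ forall A, continuity_set mu A ->
        fine (nu i A) @[i --> U] --> fine (mu A),
      forall phi : X -> R, continuous phi ->
        (\int[nu i]_x phi x) @[i --> U] --> \int[mu]_x phi x &
      (forall A : set (borel X), measurable A ->
        (fine (nu i (f @^-1` A)) - fine (nu i A)) @[i --> U] --> (0 : R)) ->
      invariant_measures f mu].
Proof.
move=> UU; pose m (A : set X) : R := lim (fine (nu i A) @[i --> U]).
have mcvg (A : set (borel X)) : measurable A -> fine (nu i A) @[i --> U] --> m A.
  move=> mA; apply: (@ultra_bounded_cvg R I U _ 1) => i.
  have hnu := probability_fin_additive (nu i).
  rewrite ger0_norm ?(fa_ge0 hnu) //.
  by rewrite -[leRHS](fa_setT hnu); apply: (fa_le hnu).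
have hm : fin_additive m.
  split.
  - move=> A mA; apply: (cvgr_to_ge (mcvg A mA)); apply: nearW => i.
    exact: fine_ge0.
  - apply: cvg_lim; first exact: Rhausdorff.
    under eq_fun do rewrite probability_setT; exact: cvg_cst.
  - move=> A B mA mB AB; apply: cvg_lim; first exact: Rhausdorff.
    have -> : (fun i => fine (nu i (A `|` B))) =
        (fun i => fine (nu i A) + fine (nu i B)).
      by apply/funext => i; rewrite (fa_setU (probability_fin_additive (nu i))).
    by apply: cvgD; exact: mcvg.
have [mu hmu] := fin_additive_measure hX hm; exists mu.
have cset A : continuity_set mu A -> fine (nu i A) @[i --> U] --> fine (mu A).
  move=> cA; rewrite -(continuity_set_eq hm hmu cA); apply: mcvg; exact: cA.1.
split => //.
- move=> phi cphi; apply/cvgrPdist_le => e e0; have e3 : 0 < e / 3 by lra.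
  have [k [xi [c [cxi cE]]]] := step_approximation hX mu cphi e3.
  have mxi i : measurable (xi @^-1` [set i] : set (borel X)) by exact: (cxi i).1.
  have lim : (\sum_i c i * fine (nu j (xi @^-1` [set i]))) @[j --> U] -->
      \sum_i c i * fine (mu (xi @^-1` [set i])).
    apply: cvg_big => [|i _]; first exact: add_continuous.
    by apply: cvgMr; exact: cset.
  have /cvgrPdist_le/(_ _ e3) := lim; apply: filterS => j Hj.
  have h1 := Rintegral_labelled hX mu cphi mxi cE.
  have h2 := Rintegral_labelled hX (nu j) cphi mxi cE.
  by move: Hj h1 h2; rewrite !ler_norml => /andP[? ?] /andP[? ?] /andP[? ?];
    apply/andP; split; lra.
- move=> inv; apply: (invariant_of_content hm hmu) => A mA.
  apply/eqP; rewrite -subr_eq0; apply/eqP.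
  have mfA : measurable (f @^-1` A : set (borel X)) by exact: measurable_preimage.
  apply: (cvg_unique _ _ (inv A mA)); first exact: Rhausdorff.
  by apply: cvgB; exact: mcvg.
Qed.

Lemma compact_invariant_measures : compact (@invariant_measures R X f).
Proof.
rewrite compact_ultra => U UU Uinv.
have [mu [_ hint hinv]] := ultra_weak_limit (fun nu : borel_prob X => nu) UU.
exists mu; split; last exact: cvg_borel_prob.
apply: hinv => A mA; apply: cvg_near_cst; apply: filterS Uinv => nu inu.
by rewrite inu // subrr.
Qed.

End WeakLimits.

(** * Convex combinations of measures *)

Section Mixtures.
Variables (R : realType) (X : pointedMetricType R).
Hypothesis hX : compact [set: X].
Implicit Types (mu nu : probability (borel X) R) (phi : X -> R).

(** Only Borel sets are constrained, since the other values of a probability are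
    arbitrary; a convex combination is therefore a relation and not a function. *)
Definition mixture (I : finType) (w : I -> R) (P : I -> probability (borel X) R)
    nu : Prop :=
  forall A : set (borel X), measurable A ->
    fine (nu A) = \sum_i w i * fine (P i A).

Definition is_mixture2 (t : R) mu nu lam : Prop :=
  forall A : set (borel X), measurable A ->
    fine (lam A) = (1 - t) * fine (mu A) + t * fine (nu A).

Lemma mixture_ex (n : nat) (w : 'I_n.+1 -> R)
    (P : 'I_n.+1 -> probability (borel X) R) :
  (forall i, 0 <= w i) -> \sum_i w i = 1 -> exists nu, mixture w P nu.
Proof.
move=> w0 w1.
pose m := msum (fun j => mscale (NngNum (w0 (inord j))) (P (inord j))) n.+1.
have mE (A : set (borel X)) : m A = (\sum_(i < n.+1) (w i)%:E * P i A)%E.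
  by rewrite /m /msum /mscale; apply: eq_bigr => i _ /=; rewrite inord_val.
have mT : m setT = 1%E.
  rewrite mE; under eq_bigr do rewrite probability_setT mule1.
  by rewrite sumEFin w1.
pose nu : probability (borel X) R := HB.pack_for (probability (borel X) R)
  (m : set (borel X) -> \bar R) (Measure.on m)
  (Measure_isProbability.Build _ _ _ m mT).
exists nu => A mA; change (fine (m A) = \sum_i w i * fine (P i A)); rewrite mE.
have -> : (\sum_(i < n.+1) (w i)%:E * P i A)%E =
    (\sum_(i < n.+1) (w i * fine (P i A))%:E)%E.
  by apply: eq_bigr => i _; rewrite EFinM fineK // fin_num_measure.
by rewrite sumEFin.
Qed.

Lemma mixture2_ex (t : R) mu nu : 0 <= t <= 1 ->
  exists lam : probability (borel X) R, is_mixture2 t mu nu lam.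
Proof.
move=> /andP[t0 t1].
pose w (i : 'I_2) := if i == 0 then 1 - t else t.
pose P (i : 'I_2) := if i == 0 then mu else nu.
have [||lam Hlam] := @mixture_ex 1 w P.
- by move=> i; rewrite /w; case: ifP => // _; rewrite subr_ge0.
- by rewrite big_ord_recl big_ord1 /w /= subrK.
by exists lam => A mA; rewrite (Hlam A mA) big_ord_recl big_ord1 /w /P /=.
Qed.

(** All the measures involved assign nearly the same integral to a step function
    close to phi, for which the formula holds by definition. *)
Lemma mixture_Rintegral (I : finType) (w : I -> R)
    (P : I -> probability (borel X) R) nu phi :
  (forall i, 0 <= w i) -> \sum_i w i = 1 -> mixture w P nu -> continuous phi ->
  \int[nu]_x phi x = \sum_i w i * \int[P i]_x phi x.
Proof.
move=> w0 w1 mix cphi; apply/eqP; rewrite -subr_eq0 -normr_eq0; apply/eqP.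
apply/eqP; rewrite eq_le normr_ge0 andbT; apply/ler_addgt0Pr => e e0.
have e2 : 0 < e / 2 by lra.
have [k [xi [c [cxi cE]]]] := step_approximation hX nu cphi e2.
have mxi i : measurable (xi @^-1` [set i] : set (borel X)) by exact: (cxi i).1.
have h1 := Rintegral_labelled hX nu cphi mxi cE.
have h2 i := Rintegral_labelled hX (P i) cphi mxi cE.
have h3 : `|\sum_i w i * \int[P i]_x phi x -
    \sum_j c j * fine (nu (xi @^-1` [set j]))| <= e / 2.
  have -> : \sum_j c j * fine (nu (xi @^-1` [set j])) =
      \sum_i w i * \sum_j c j * fine (P i (xi @^-1` [set j])).
    under eq_bigr => j _ do rewrite (mix _ (mxi j)) mulr_sumr.
    rewrite exchange_big; apply: eq_bigr => i _; rewrite mulr_sumr.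
    by apply: eq_bigr => j _; rewrite mulrCA.
  rewrite -sumrB; apply: le_trans (ler_norm_sum _ _ _) _.
  rewrite -[leRHS]mul1r -[X in _ <= X * _]w1 mulr_suml; apply: ler_sum => i _.
  rewrite -mulrBr normrM (ger0_norm (w0 i)); apply: ler_wpM2l; first exact: w0.
  exact: h2.
move: h1 h3; rewrite add0r !ler_norml => /andP[? ?] /andP[? ?]; apply/andP; split; lra.
Qed.

Lemma mixture2_Rintegral (t : R) mu nu (lam : probability (borel X) R) phi : 0 <= t <= 1 ->
  is_mixture2 t mu nu lam ->
  continuous phi ->
  \int[lam]_x phi x = (1 - t) * \int[mu]_x phi x + t * \int[nu]_x phi x.
Proof.
move=> /andP[t0 t1] Hlam cphi.
pose w (i : 'I_2) := if i == 0 then 1 - t else t.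
pose P (i : 'I_2) := if i == 0 then mu else nu.
rewrite (@mixture_Rintegral _ w P) //.
- by rewrite big_ord_recl big_ord1 /w /P.
- by move=> i; rewrite /w; case: ifP => // _; rewrite subr_ge0.
- by rewrite big_ord_recl big_ord1 /w /= subrK.
- by move=> A mA; rewrite (Hlam A mA) big_ord_recl big_ord1 /w /P.
Qed.

End Mixtures.

(** * Empirical measures and their limits *)

Section Empirical.
Variables (R : realType) (X : pointedMetricType R) (f : X -> X).
Hypothesis hX : compact [set: X].
Implicit Types (phi : X -> R).

Lemma empirical_mixture (x : X) (n : nat) :
  mixture (fun=> n.+1%:R^-1)
    (fun j : 'I_n.+1 => @dirac _ (borel X) (iter j f x) R) (empirical f x n).
Proof.
move=> A mA; rewrite -mulr_sumr.
transitivity (fine ((n.+1%:R^-1)%:E *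
  \sum_(j < n.+1) @dirac _ (borel X) (iter j f x) R A)%E); first by [].
rewrite (eq_bigr (fun i : 'I_n.+1 => (\1_A (iter i f x))%:E)); last by move=> i _; rewrite diracE.
by rewrite sumEFin -EFinM.
Qed.

Lemma empirical_Rintegral (x : X) (n : nat) phi : continuous phi ->
  \int[empirical f x n]_y phi y = birkhoff_sum f phi n.+1 x / n.+1%:R.
Proof.
move=> cphi; rewrite (mixture_Rintegral hX _ _ (@empirical_mixture x n)) //.
- rewrite /birkhoff_sum mulr_suml; apply: eq_bigr => i _; rewrite mulrC; congr (_ * _).
  rewrite /Rintegral integral_dirac //=; last first.
    by apply/measurable_EFinP; exact: continuous_measurable.
  by rewrite indicE in_setT mul1r.
- by rewrite sumr_const card_ord -[_ *+ _]mulr_natr mulVf.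
Qed.

(** The two sums over the orbit differ by their first and last terms. *)
Lemma empirical_defect (x : X) (n : nat) (A : set (borel X)) : measurable A ->
  measurable (f @^-1` A : set (borel X)) ->
  `|fine (empirical f x n (f @^-1` A)) - fine (empirical f x n A)| <= n.+1%:R^-1.
Proof.
move=> mA mfA; rewrite (empirical_mixture x n mA) (empirical_mixture x n mfA).
rewrite -!mulr_sumr -mulrBr normrM ger0_norm ?invr_ge0 //.
rewrite -[leRHS]mulr1; apply: ler_wpM2l; first by rewrite invr_ge0.
rewrite big_ord_recr [X in _ - X]big_ord_recl /= [X in _ - X]addrC opprD addrACA.
rewrite (_ : \sum_(i < n) _ - _ = 0) ?add0r; last first.
  by apply/eqP; rewrite subr_eq0 /bump; apply/eqP; apply: eq_bigr => i _; rewrite !indicE.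
rewrite !indicE /= ler_norml.
by case: (_ \in _); case: (_ \in _); rewrite /= ?subr0 ?sub0r ?subrr; lra.
Qed.

(** The Krylov-Bogoliubov argument. The hypothesis on nu holds for empirical
    measures and for their mixtures. *)
Lemma invariant_limit (hf : continuous f) (U : set_system nat)
    (nu : nat -> probability (borel X) R) : UltraFilter U -> \oo `<=` U ->
  (forall n (A : set (borel X)), measurable A ->
     `|fine (nu n (f @^-1` A)) - fine (nu n A)| <= n.+1%:R^-1) ->
  exists mu : probability (borel X) R,
  [/\ invariant_measures f mu, forall A, continuity_set mu A ->
        fine (nu i A) @[i --> U] --> fine (mu A) &
      forall phi : X -> R, continuous phi ->
        (\int[nu i]_x phi x) @[i --> U] --> \int[mu]_x phi x].
Proof.
move=> UU Uoo H; have [mu [h1 h2 h3]] := ultra_weak_limit hX hf nu UU.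
exists mu; split => //; apply: h3 => A mA; apply/cvgrPdist_le => e e0.
have /cvgrPdist_le/(_ _ e0) := @cvg_harmonic R.
move/Uoo; apply: filterS => n; rewrite sub0r normrN ger0_norm ?invr_ge0 // => ne.
by rewrite sub0r normrN; exact: le_trans (H n A mA) ne.
Qed.

End Empirical.

(** * Entropy of labellings *)

Section Labels.
Variables (R : realType) (X : pointedMetricType R).

Definition measurable_label (E : finType) (z : X -> E) : Prop :=
  forall e, measurable (z @^-1` [set e] : set (borel X)).

Lemma fa_label (m : set X -> R) (E : finType) (z : X -> E) (P : pred E) :
  fin_additive m -> measurable_label z ->
  m [set x | P (z x)] = \sum_(e | P e) m (z @^-1` [set e]).
Proof.
move=> hm mz.
have aux (s : seq E) : uniq s ->
    measurable ([set x | z x \in s] : set (borel X)) /\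
    m [set x | z x \in s] = \sum_(e <- s) m (z @^-1` [set e]).
  elim: s => [_|e s IH /= /andP[es us]].
    rewrite big_nil (_ : [set _ | _] = set0); last by apply/seteqP; split.
    by split; [exact: measurable0|exact: fa_set0].
  have [IH1 IH2] := IH us.
  have -> : [set x | z x \in e :: s] = z @^-1` [set e] `|` [set x | z x \in s].
    apply/seteqP; split=> x /=; rewrite inE; first by case/orP => [/eqP|]; [left|right].
    by case=> [->|->]; rewrite ?eqxx ?orbT.
  split; first exact: measurableU.
  rewrite big_cons -IH2 (fa_setU hm) //.
  by apply/seteqP; split=> x //= [-> h]; rewrite h in es.
have [_ h] := aux (enum P) (enum_uniq P).
rewrite -big_enum /= -h; congr (m _).
by apply/seteqP; split=> x /=; rewrite mem_enum.
Qed.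

Lemma law_label (mu : probability (borel X) R) (E T : finType) (z : X -> E)
    (g : E -> T) (t : T) : measurable_label z ->
  fine (mu ((g \o z) @^-1` [set t])) =
  law (fun e => fine (mu (z @^-1` [set e]))) g t.
Proof.
move=> mz; rewrite /law -(fa_label (fun e => g e == t) (probability_fin_additive mu) mz).
by congr (fine (mu _)); apply/seteqP; split=> x /= /eqP.
Qed.

Lemma label_sum1 (mu : probability (borel X) R) (E : finType) (z : X -> E) :
  measurable_label z -> \sum_e fine (mu (z @^-1` [set e])) = 1.
Proof.
move=> mz; have hmu := probability_fin_additive mu.
rewrite -(fa_setT hmu) -(fa_label xpredT hmu mz).
by congr (fine (mu _)); apply/seteqP; split.
Qed.

Lemma partition_entropyE (mu : probability (borel X) R) (E : finType) (z : X -> E) :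
  partition_entropy mu z = shannon (fun e => fine (mu (z @^-1` [set e]))).
Proof. by []. Qed.

Lemma partition_entropy_ge0 (mu : probability (borel X) R) (E : finType)
  (z : X -> E) : measurable_label z -> 0 <= partition_entropy mu z.
Proof.
move=> mz; apply: shannon_ge0 => e; have hmu := probability_fin_additive mu.
by rewrite (fa_ge0 hmu) //= -(fa_setT hmu) (fa_le hmu).
Qed.

Lemma partition_entropy_le (mu : probability (borel X) R) (E : finType)
  (z : X -> E) : measurable_label z -> partition_entropy mu z <= ln #|E|%:R.
Proof.
move=> mz; apply: shannon_le_ln_card; last exact: label_sum1.
by move=> e; exact: fine_ge0.
Qed.

Variable f : X -> X.

(** Stated for an abstract class G of sets because it is used both for Borel
    sets and for continuity sets. *)
Lemma join_cells (G : set X -> Prop) (T : finType) (xi : X -> T) (n : nat) :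
  G setT -> (forall A B, G A -> G B -> G (A `&` B)) ->
  (forall A, G A -> G (f @^-1` A)) -> (forall t, G (xi @^-1` [set t])) ->
  forall w, G (partition_join f xi n @^-1` [set w]).
Proof.
move=> GT GI Gf Gxi w.
have Gi i A : G A -> G (iter i f @^-1` A).
  elim: i A => [//|i IH] A GA.
  by rewrite (_ : _ @^-1` A = iter i f @^-1` (f @^-1` A)) //; apply: IH; exact: Gf.
have aux (s : seq 'I_n) :
    G [set x | all (fun i : 'I_n => xi (iter i f x) == w i) s].
  elim: s => [|i s IH] /=.
    by rewrite (_ : [set _ | _] = setT) //; apply/seteqP; split.
  rewrite (_ : [set _ | _] = iter i f @^-1` (xi @^-1` [set w i]) `&`
      [set x | all (fun i : 'I_n => xi (iter i f x) == w i) s]).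
    by apply: GI => //; exact: Gi.
  by apply/seteqP; split=> x /=; [case/andP => /eqP|case=> -> ->; rewrite eqxx].
rewrite (_ : _ @^-1` _ =
  [set x | all (fun i : 'I_n => xi (iter i f x) == w i) (enum 'I_n)]) //.
apply/seteqP; split=> x /=; first by move=> <-; apply/allP => i _; rewrite ffunE.
by move=> /allP H; apply/ffunP => i; rewrite ffunE; apply/eqP/H; rewrite mem_enum.
Qed.

Hypothesis hf : continuous f.

Lemma measurable_join (T : finType) (xi : X -> T) n :
  measurable_label xi -> measurable_label (partition_join f xi n).
Proof.
move=> mxi; apply: (@join_cells (fun A => measurable (A : set (borel X)))) => //.
- by move=> A B; exact: measurableI.
- by move=> A; exact: measurable_preimage.
Qed.

Lemma invariant_iter (mu : probability (borel X) R) i (A : set (borel X)) :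
  invariant_measures f mu -> measurable A -> mu (iter i f @^-1` A) = mu A.
Proof.
move=> inv; elim: i A => [//|i IH] A mA.
rewrite (_ : _ @^-1` A = iter i f @^-1` (f @^-1` A)) // IH ?inv //.
exact: measurable_preimage.
Qed.

Section JoinEntropy.
Variables (mu : probability (borel X) R) (T : finType) (xi : X -> T).
Hypotheses (inv : invariant_measures f mu) (mxi : measurable_label xi).

Let H n := partition_entropy mu (partition_join f xi n).

(** A word of length l1 + l2 is the pair of its first l1 and last l2 letters, and
    by invariance the last letters have the same law as a word of length l2. *)
Lemma join_entropy_subadd l1 l2 : H (l1 + l2) <= H l1 + H l2.
Proof.
have mj n := @measurable_join _ _ n mxi.
pose E := {ffun 'I_(l1 + l2) -> T}.
pose w (e : E) := fine (mu (partition_join f xi (l1 + l2) @^-1` [set e])).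
pose g (e : E) : {ffun 'I_l1 -> T} := [ffun i => e (lshift l2 i)].
pose g' (e : E) : {ffun 'I_l2 -> T} := [ffun i => e (rshift l1 i)].
have w0 e : 0 <= w e by exact: fine_ge0.
have w1 : \sum_e w e = 1 by exact: label_sum1.
pose h (t : {ffun 'I_l1 -> T}) (s : {ffun 'I_l2 -> T}) : E :=
  [ffun i : 'I_(l1 + l2) => match fintype.split i with inl a => t a | inr b => s b end].
have hE e : e = h (g e) (g' e).
  apply/ffunP => i; rewrite ffunE; case: fintype.splitP => j ij; rewrite ffunE;
    by congr (e _); apply/val_inj.
have := shannon_join w0 w1 hE.
congr (_ <= _ + _).
- rewrite /H partition_entropyE; congr shannon; apply/funext => e.
  by rewrite /law (big_pred1 e).
- rewrite /H partition_entropyE; congr shannon; apply/funext => t.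
  have <- : g \o partition_join f xi (l1 + l2) = partition_join f xi l1.
    by apply/funext => x; apply/ffunP => i; rewrite !ffunE.
  by rewrite law_label.
- rewrite /H partition_entropyE; congr shannon; apply/funext => t.
  rewrite -(invariant_iter l1 inv); last exact: mj.
  rewrite -comp_preimage.
  have <- : g' \o partition_join f xi (l1 + l2) = partition_join f xi l2 \o iter l1 f.
    by apply/funext => x; apply/ffunP => i; rewrite !ffunE /= addnC iterD.
  by rewrite law_label.
Qed.

Lemma join_entropy_ge0 n : 0 <= H n.
Proof. by apply: partition_entropy_ge0; exact: measurable_join. Qed.

Lemma card_label_gt0 : (0 < #|T|)%N.
Proof. by apply/card_gt0P; exists (xi point). Qed.

Lemma ln_card_label_ge0 : 0 <= ln #|T|%:R :> R.
Proof. by apply: ln_ge0; rewrite ler1n card_label_gt0. Qed.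

Lemma join_entropy_le n : H n <= n%:R * ln #|T|%:R.
Proof.
apply: le_trans (partition_entropy_le _ (@measurable_join _ _ n mxi)) _.
rewrite card_ffun card_ord natrX lnXn ?ltr0n ?card_label_gt0 //.
by rewrite mulr_natl.
Qed.

Lemma join_entropy_average q n : (0 < q)%N ->
  q%:R * H n <= n%:R * H q + 2 * q%:R ^+ 2 * ln #|T|%:R.
Proof.
move=> q0; have := @block_averaging R (fun _ l => H l) (ln #|T|%:R) q n.
rewrite sumr_const card_ord -[_ *+ n]mulr_natl; apply => //.
- by move=> *; exact: join_entropy_subadd.
- by move=> *; exact: join_entropy_le.
- by move=> *; exact: join_entropy_ge0.
- exact: ln_card_label_ge0.
Qed.

(** Fekete's lemma: by join_entropy_average, H n / n is eventually at most
    H q / q + e for each q, so it converges to its infimum. The last clause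
    records that the limit is the infimum. *)
Lemma entropy_of_partition_cvg : exists h : R,
  [/\ entropy_of_partition f mu xi = h%:E, 0 <= h,
      (H n / n%:R) @[n --> \oo] --> h &
      forall c, (forall q, (0 < q)%N -> c <= H q / q%:R) -> c <= h].
Proof.
pose S := [set H q / q%:R | q in [set q | (0 < q)%N]].
have S0 : S !=set0 by exists (H 1 / 1%:R), 1%N.
have lbS : lbound S 0.
  by move=> _ [q q0 <-]; rewrite divr_ge0 // join_entropy_ge0.
have infS : has_inf S by split => //; exists 0.
have cv : (H n / n%:R) @[n --> \oo] --> inf S.
  apply/cvgrPdist_le => e e0.
  have e2 : 0 < e / 2 by lra.
  have [_ [q /= q0 <-] Hq] := inf_adherent e2 infS.
  pose D := 2 * q%:R * ln #|T|%:R : R.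
  have D0 : 0 <= D by rewrite mulr_ge0 // ln_card_label_ge0.
  near=> n.
  have n0 : (0 < n)%N by near: n; exists 1%N.
  have n0' : 0 < n%:R :> R by rewrite ltr0n.
  have q0' : 0 < q%:R :> R by rewrite ltr0n.
  have Dn : D / n%:R <= e / 2.
    rewrite ler_pdivrMr // mulrC -ler_pdivrMr //.
    near: n; exists (Num.trunc (D / (e / 2))).+1 => // n /= Nn.
    apply/ltW/(lt_le_trans (truncnS_gt _)); by rewrite ler_nat.
  have h1 : inf S <= H n / n%:R.
    by apply: ge_inf; [exists 0|exists n].
  have h2 : H n / n%:R <= H q / q%:R + D / n%:R.
    rewrite ler_pdivrMr // mulrDl divfK ?gt_eqF //.
    have := join_entropy_average n q0; rewrite -ler_pdivlMl // => /le_trans; apply.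
    rewrite le_eqVlt; apply/orP; left; apply/eqP; rewrite /D; field.
    by rewrite gt_eqF.
  rewrite ler_norml; apply/andP; split; lra.
exists (inf S); split => //.
- apply: cvg_lim => //; apply: cvg_EFin; last exact: cv.
  by apply: nearW.
- exact: lb_le_inf.
- by move=> c Hc; apply: lb_le_inf => // _ [q q0 <-]; exact: Hc.
Unshelve. all: by end_near. Qed.

End JoinEntropy.

(** Concavity of the entropy, keeping only the term of mu. *)
Lemma entropy_of_partition_mixture (t : R) (mu nu lam : probability (borel X) R)
    (T : finType) (xi : X -> T) (h : R) :
  0 <= t <= 1 -> invariant_measures f mu -> invariant_measures f lam ->
  is_mixture2 t mu nu lam ->
  measurable_label xi -> entropy_of_partition f mu xi = h%:E ->
  (((1 - t) * h)%:E <= entropy_of_partition f lam xi)%E.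
Proof.
move=> /andP[t0 t1] imu ilam Hlam mxi hE.
have [h' [h'E _ cvh _]] := entropy_of_partition_cvg imu mxi.
have [l [-> _ cvl _]] := entropy_of_partition_cvg ilam mxi.
move: hE; rewrite h'E => -[<-]; rewrite lee_fin.
apply: (ler_cvg_to _ cvl); first exact: cvgMr cvh.
apply: nearW => n; rewrite mulrA; apply: ler_wpM2r; first by rewrite invr_ge0.
have mj := @measurable_join _ _ n mxi.
pose c (i : 'I_2) := if i == 0 then 1 - t else t.
pose p (i : 'I_2) e :=
  fine ((if i == 0 then mu else nu) (partition_join f xi n @^-1` [set e])).
have pE : (fun e => \sum_i c i * p i e) =
    (fun e => fine (lam (partition_join f xi n @^-1` [set e]))).
  apply/funext => e; by rewrite !big_ord_recl big_ord0 addr0 /c /p /= Hlam //.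
have H : \sum_i c i * shannon (p i) <= shannon (fun e => \sum_i c i * p i e).
  apply: shannon_mixture.
  - by move=> i; rewrite /c; case: ifP => _; rewrite ?subr_ge0.
  - by move=> i e; exact: fine_ge0.
  - by move=> i j; rewrite !label_sum1.
  - by rewrite !big_ord_recl big_ord0 addr0 /c /= subrK.
rewrite pE in H; apply: le_trans H; rewrite !big_ord_recl big_ord0 addr0 /c /p /=.
by rewrite lerDl mulr_ge0 //; exact: (partition_entropy_ge0 nu mj).
Qed.

End Labels.

(** * Asymptotically additive sequences *)

Section AsymptoticallyAdditive.
Variables (R : realType) (X : pointedMetricType R) (f : X -> X).
Hypotheses (hX : compact [set: X]) (hf : continuous f).
Implicit Types (mu nu : probability (borel X) R) (psi : X -> R)
  (Phi : nat -> X -> R).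

Lemma cvg_of_approx (I : Type) (F : set_system I) (u : I -> R) :
  ProperFilter F ->
  (forall e, 0 < e -> exists c, \forall i \near F, `|u i - c| <= e) -> cvg (u @ F).
Proof.
move=> FF H; apply: cauchy_cvg; apply: cauchy_exP => e e0.
have e2 : 0 < e / 2 by lra.
have [c Hc] := H _ e2; exists c; apply: (@filterS _ F _ _ _ _ Hc) => i hi.
by rewrite /ball /= distrC; lra.
Qed.

(** The condition on the upper limit is used below only through this uniform
    bound for large n. *)
Lemma asymptotically_additive_approx Phi (d : R) :
  asymptotically_additive f Phi -> 0 < d ->
  exists2 psi, continuous psi &
    \forall n \near \oo, forall x, `|Phi n x - birkhoff_sum f psi n x| <= d * n%:R.
Proof.
move=> [cPhi H] d0; have [psi [cpsi]] := H d d0.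
set u := (X in limn_esup X) => lt; exists psi => //.
have [_ [N _ <-] HN] : exists2 y, range (esups u) y & (y < d%:E)%E.
  by apply: ereal_inf_lt; rewrite -(cvg_lim _ (@cvg_esups_inf _ u)) // -limn_esup_lim.
exists N.+1 => // n /= Nn x; have n0 : 0 < n%:R :> R by rewrite ltr0n; lia.
have un : (u n < d%:E)%E.
  apply: le_lt_trans HN; apply: ereal_sup_ubound; exists n => //=; lia.
rewrite -ler_pdivrMr // -lee_fin; apply: le_trans (ltW un).
rewrite mulrC EFinM /u; apply: lee_wpmul2l; first by rewrite lee_fin invr_ge0.
by apply: ereal_sup_ubound; exists x.
Qed.

Lemma iter_continuous i : continuous (iter i f).
Proof.
by elim: i => [|j IH] y; [exact: cvg_id|apply: continuous_comp; [exact: IH|exact: hf]].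
Qed.

Lemma birkhoff_sum_continuous psi n : continuous psi -> continuous (birkhoff_sum f psi n).
Proof.
move=> cpsi x; rewrite /birkhoff_sum.
apply: cvg_big => [|i _]; first exact: add_continuous.
exact: (continuous_comp (@iter_continuous i x) (cpsi _)).
Qed.

Lemma Rintegral_comp mu psi : invariant_measures f mu -> continuous psi ->
  \int[mu]_x psi (f x) = \int[mu]_x psi x.
Proof.
move=> inv cpsi; apply/eqP; rewrite -subr_eq0 -normr_eq0 eq_le normr_ge0 andbT.
apply/ler_addgt0Pr => e e0.
have e2 : 0 < e / 2 by lra.
have [k [xi [c [cxi cE]]]] := step_approximation hX mu cpsi e2.
have mxi i : measurable (xi @^-1` [set i] : set (borel X)) by exact: (cxi i).1.
have h1 := Rintegral_labelled hX mu cpsi mxi cE.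
have cpf : continuous (psi \o f) by move=> x; apply: continuous_comp; [exact: hf|exact: cpsi].
have mxf i : measurable ((xi \o f) @^-1` [set i] : set (borel X)).
  by rewrite comp_preimage; exact: measurable_preimage.
have h2 := Rintegral_labelled hX mu cpf mxf (fun x => cE (f x)).
have E : \sum_i c i * fine (mu ((xi \o f) @^-1` [set i])) =
    \sum_i c i * fine (mu (xi @^-1` [set i])).
  by apply: eq_bigr => i _; rewrite comp_preimage inv.
rewrite E in h2; move: h1 h2; rewrite /comp add0r !ler_norml => /andP[? ?] /andP[? ?].
by apply/andP; split; lra.
Qed.

Lemma birkhoff_sum_Rintegral mu psi n : invariant_measures f mu -> continuous psi ->
  \int[mu]_x birkhoff_sum f psi n x = n%:R * \int[mu]_x psi x.
Proof.
move=> inv cpsi; elim: n => [|n IH].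
  rewrite mul0r -[RHS](Rintegral_cst_probability mu); congr (Rintegral _ _ _).
  by apply/funext => x; rewrite /birkhoff_sum big_ord0.
have it i : \int[mu]_x psi (iter i f x) = \int[mu]_x psi x.
  elim: i psi cpsi {IH} => [//|i IH] psi cpsi.
  rewrite -[RHS](Rintegral_comp inv cpsi).
  by apply: (IH (psi \o f)) => x; apply: continuous_comp; [exact: hf|exact: cpsi].
have -> : birkhoff_sum f psi n.+1 = (fun x => birkhoff_sum f psi n x + psi (iter n f x)).
  by apply/funext => x; rewrite /birkhoff_sum big_ord_recr.
have citer : continuous (fun x => psi (iter n f x)).
  by move=> x; exact: (continuous_comp (@iter_continuous n x) (cpsi _)).
rewrite RintegralD //; last 2 first.
- by apply: continuous_integrable => //; exact: birkhoff_sum_continuous.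
- exact: continuous_integrable.
by rewrite IH it -natr1 mulrDl mul1r.
Qed.

Lemma mean_value_approx Phi mu psi (d : R) :
  asymptotically_additive f Phi -> invariant_measures f mu -> continuous psi ->
  (\forall n \near \oo, forall x, `|Phi n x - birkhoff_sum f psi n x| <= d * n%:R) ->
  \forall n \near \oo, `|\int[mu]_x (Phi n x / n%:R) - \int[mu]_x psi x| <= d.
Proof.
move=> [cPhi _] inv cpsi H; near=> n.
have n0 : (0 < n)%N by near: n; exists 1%N.
have n0' : 0 < n%:R :> R by rewrite ltr0n.
have cP (g : X -> R) : continuous g -> continuous (fun x => g x / n%:R).
  by move=> cg x; apply: cvgMl; exact: cg.
have -> : \int[mu]_x psi x = \int[mu]_x (birkhoff_sum f psi n x / n%:R).
  rewrite RintegralZr //; last by apply: continuous_integrable => //; exact: birkhoff_sum_continuous.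
  by rewrite birkhoff_sum_Rintegral // mulrAC divff ?mul1r // gt_eqF.
apply: Rintegral_le_dist.
- by apply: continuous_integrable => //; apply: cP; exact: cPhi.
- by apply: continuous_integrable => //; apply: cP; exact: birkhoff_sum_continuous.
- move=> x; rewrite -mulrBl normrM (ger0_norm (x := n%:R^-1)) ?invr_ge0 ?ler0n //.
  rewrite ler_pdivrMr //; move: x; near: n; exact: H.
Unshelve. all: by end_near. Qed.

(** The integrals of Phi n / n stay within e of the integral of psi, for every
    e and a suitable psi, hence form a Cauchy sequence. *)
Lemma mean_value_cvg Phi mu : asymptotically_additive f Phi ->
  invariant_measures f mu ->
  (\int[mu]_x (Phi n x / n%:R)) @[n --> \oo] --> mean_value Phi mu.
Proof.
move=> aPhi inv; apply: cvg_of_approx => e e0.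
have [psi cpsi H] := asymptotically_additive_approx aPhi e0.
by exists (\int[mu]_x psi x); exact: mean_value_approx.
Qed.

Lemma mean_value_dist Phi mu psi (d : R) :
  asymptotically_additive f Phi -> invariant_measures f mu -> continuous psi ->
  (\forall n \near \oo, forall x, `|Phi n x - birkhoff_sum f psi n x| <= d * n%:R) ->
  `|mean_value Phi mu - \int[mu]_x psi x| <= d.
Proof.
move=> aPhi inv cpsi H.
have c : `|\int[mu]_x (Phi n x / n%:R) - \int[mu]_x psi x| @[n --> \oo] -->
    `|mean_value Phi mu - \int[mu]_x psi x|.
  by apply: cvg_norm; apply: cvgB; [exact: mean_value_cvg|exact: cvg_cst].
by apply: (cvgr_to_le c); exact: mean_value_approx.
Qed.

Lemma mean_value_bounded Phi : asymptotically_additive f Phi ->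
  exists B, forall mu, invariant_measures f mu -> `|mean_value Phi mu| <= B.
Proof.
move=> aPhi; have [psi cpsi H] := asymptotically_additive_approx aPhi ltr01.
have [B HB] := continuous_bounded hX cpsi.
exists (1 + B) => mu inv; have h1 := mean_value_dist aPhi inv cpsi H.
have h2 := Rintegral_bound hX mu cpsi HB.
by move: h1 h2; rewrite !ler_norml => /andP[? ?] /andP[? ?]; apply/andP; split; lra.
Qed.

Lemma mean_value_mixture Phi (t : R) mu nu (lam : probability (borel X) R) :
  asymptotically_additive f Phi -> 0 <= t <= 1 ->
  invariant_measures f mu -> invariant_measures f nu -> invariant_measures f lam ->
  is_mixture2 t mu nu lam ->
  mean_value Phi lam = (1 - t) * mean_value Phi mu + t * mean_value Phi nu.
Proof.
move=> aPhi t01 imu inu ilam Hlam.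
have c1 := mean_value_cvg aPhi ilam.
have c2 : ((1 - t) * \int[mu]_x (Phi n x / n%:R) +
    t * \int[nu]_x (Phi n x / n%:R)) @[n --> \oo] -->
    (1 - t) * mean_value Phi mu + t * mean_value Phi nu.
  by apply: cvgD; apply: cvgMr; exact: mean_value_cvg.
apply: (cvg_unique _ c1); first exact: Rhausdorff.
apply: cvg_trans c2; apply: near_eq_cvg; near=> n.
have n0 : (0 < n)%N by near: n; exists 1%N.
rewrite (mixture2_Rintegral hX t01 Hlam) // => x; apply: cvgMl.
by have [cPhi _] := aPhi; exact: cPhi.
Unshelve. all: by end_near. Qed.

(** If every invariant measure gave Psi the same mean value a, then Psi_n(x)/n
    would converge to a along every ultrafilter, hence along the integers. *)
Lemma irregular_mean_value Psi (a : R) : irregular_sequence f Psi ->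
  exists2 nu : probability (borel X) R, invariant_measures f nu &
    mean_value Psi nu <> a.
Proof.
move=> [aPsi [x irr]]; apply: contrapT => no; apply: irr; apply/cvg_ex; exists a.
rewrite -(cvg_shiftS (fun n => Psi n x / n%:R)) /=.
apply: cvg_ultra => U UU Uoo.
have [nu [inv _ hint]] := @invariant_limit R X f hX hf U (fun n => empirical f x n) UU Uoo
  (fun n A mA => empirical_defect x n mA (measurable_preimage hf mA)).
have <- : mean_value Psi nu = a by apply: contrapT => ne; apply: no; exists nu.
apply/cvgrPdist_le => e e0; have e3 : 0 < e / 3 by lra.
have [psi cpsi H] := asymptotically_additive_approx aPsi e3.
have h1 := mean_value_dist aPsi inv cpsi H.
have /cvgrPdist_le/(_ _ e3) := hint _ cpsi.
have [N _ HN] := H.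
have : U [set n | (N <= n)%N] by apply: Uoo; exists N.
apply: filterS2 => n Nn; rewrite empirical_Rintegral //.
have h2 : `|Psi n.+1 x / n.+1%:R - birkhoff_sum f psi n.+1 x / n.+1%:R| <= e / 3.
  rewrite -mulrBl normrM (ger0_norm (x := n.+1%:R^-1)) ?invr_ge0 ?ler0n //.
  by rewrite ler_pdivrMr ?ltr0n //; apply: HN => /=; rewrite ltnW.
move: h1 h2; set p := Psi n.+1 x / _; set q := birkhoff_sum _ _ _ _ / _.
set r := Rintegral _ _ _.
rewrite !ler_norml => /andP[? ?] /andP[? ?] /andP[? ?].
by apply/andP; split; lra.
Qed.

(** A measure in K is a limit point of the empirical measures of x, and the
    average of psi over the orbit of x is close to Psi n x / n when psi is an
    approximation of Psi. *)
Lemma saturated_mean_value Psi (K : set (borel_prob X)) (x : X) (l : R)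
    (lam : borel_prob X) : asymptotically_additive f Psi ->
  K lam -> invariant_measures f lam -> saturated_set f K x ->
  Psi n x / n%:R @[n --> \oo] --> l -> mean_value Psi lam = l.
Proof.
move=> aPsi Klam inv satx cl.
apply/eqP; rewrite -subr_eq0 -normr_eq0 eq_le normr_ge0 andbT.
apply/ler_addgt0Pr => e e0; rewrite add0r; have e4 : 0 < e / 4 by lra.
have [psi cpsi H] := asymptotically_additive_approx aPsi e4.
have h1 := mean_value_dist aPsi inv cpsi H.
have [N1 _ HN1] := H; have /cvgrPdist_le/(_ _ e4)[N2 _ HN2] := cl.
have : limit_measures f x lam by rewrite satx.
have /cvgrPdist_lt/(_ _ e4) nb := @weak_eval_continuous R X psi cpsi lam.
pose good := [set n | (N1 <= n)%N /\ (N2 <= n)%N].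
move=> /(_ (empirical_prob f x @` good) _ _ nb)[].
  exists (maxn N1 N2) => // n /=; rewrite geq_max => /andP[n1 n2].
  by exists n.
move=> _ [[n [n1 n2] <-]] /=.
rewrite /empirical_prob empirical_Rintegral // => /ltW h2.
have h3 : `|Psi n.+1 x / n.+1%:R - birkhoff_sum f psi n.+1 x / n.+1%:R| <= e / 4.
  rewrite -mulrBl normrM (ger0_norm (x := n.+1%:R^-1)) ?invr_ge0 ?ler0n //.
  by rewrite ler_pdivrMr ?ltr0n //; apply: HN1 => /=; rewrite ltnW.
have h4 := HN2 n.+1 (leqW n2).
move: h1 h2 h3 h4; set p := Psi n.+1 x / _; set q := birkhoff_sum _ _ _ _ / _.
set r := Rintegral _ _ _.
rewrite !ler_norml => /andP[? ?] /andP[? ?] /andP[? ?] /andP[? ?].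
by apply/andP; split; lra.
Qed.

End AsymptoticallyAdditive.

(** * Topological pressure *)

Section AlmostMonotone.
Variable R : realType.

(** The pressure at scale eps is not monotone in eps, since smaller balls give
    smaller suprema of Phi n; it is monotone up to an error that vanishes with
    eps, which is enough for the limit to exist. The limit is the supremum L of
    the eventual lower bounds. *)
Lemma almost_nonincreasing_cvg (P : R -> \bar R) :
  (forall rho, 0 < rho -> exists2 e0, 0 < e0 & forall e e', 0 < e' -> e' <= e ->
     e < e0 -> (P e <= P e' + rho%:E)%E) ->
  cvg (P e @[e --> 0^'+]).
Proof.
move=> HP; pose A := [set c : R | \forall e \near 0^'+, (c%:E <= P e)%E].
pose L := ereal_sup [set c%:E | c in A].
have low (c : R) : (c%:E < L)%E -> \forall e \near 0^'+, (c%:E < P e)%E.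
  move=> /ereal_sup_gt[_ [a Aa <-] ca].
  by apply: filterS Aa => e; exact: lt_le_trans.
have mid (x : \bar R) (c : R) : (x < c%:E)%E -> exists c', (x < c'%:E)%E /\ c' < c.
  case: x => [l| |] // lc; last by exists (c - 1); rewrite ltNyr; split => //; lra.
  by move: lc; rewrite lte_fin => lc; exists ((l + c) / 2); rewrite lte_fin; split; lra.
have up (c : R) : (L < c%:E)%E -> \forall e \near 0^'+, (P e < c%:E)%E.
  move=> /mid[c' [Lc' cc']].
  pose rho := (c - c') / 2; have rho0 : 0 < rho by rewrite /rho; lra.
  have [e0 e00 H] := HP rho rho0.
  near=> e; rewrite ltNge; apply/negP => cP.
  have ee0 : 0 < e by near: e; exact: nbhs_right_gt.
  have ee1 : e < e0 by near: e; exact: nbhs_right_lt.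
  have : (c'%:E <= L)%E.
    apply: ereal_sup_ubound; exists c' => //=; near=> e'.
    have h1 : 0 < e' by near: e'; exact: nbhs_right_gt.
    have h2 : e' <= e by near: e'; exact: nbhs_right_le.
    have := le_trans cP (H e e' h1 h2 ee1); rewrite -leeBlDr // => h.
    by apply: le_trans h; rewrite -EFinB lee_fin /rho; lra.
  by rewrite leNgt Lc'.
apply/cvg_ex; exists L; clearbody L; case: L low up => [l| |] low up.
- apply/fine_cvgP; split.
    near=> e; rewrite fin_numElt; apply/andP; split.
      apply: lt_trans (ltNyr (l - 1)) _; near: e; apply: low.
      by rewrite lte_fin; lra.
    apply: lt_trans _ (ltry (l + 1)); near: e; apply: up.
    by rewrite lte_fin; lra.
  apply/cvgrPdist_lt => d d0; near=> e.
  have h1 : ((l - d)%:E < P e)%E by near: e; apply: low; rewrite lte_fin; lra.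
  have h2 : (P e < (l + d)%:E)%E by near: e; apply: up; rewrite lte_fin; lra.
  move: h1 h2; rewrite /=; case: (P e) => [p| |] //; rewrite !lte_fin /= => h1 h2.
  by rewrite ltr_norml; apply/andP; split; lra.
- apply/cvgeyPgt => c; apply: low; exact: ltry.
- apply/cvgeNyPlt => c; apply: up; exact: ltNyr.
Unshelve. all: by end_near. Qed.

End AlmostMonotone.

Section PressureBasics.
Variables (R : realType) (X : pointedMetricType R) (f : X -> X).
Hypotheses (hX : compact [set: X]) (hf : continuous f).
Variable Phi : nat -> X -> R.
Hypothesis hPhi : asymptotically_additive f Phi.
Implicit Types (Z : set X).

Lemma bowen_ball_center n x eps : 0 < eps -> bowen_ball f n x eps x.
Proof. by move=> e0 i _; rewrite mdistxx. Qed.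

Lemma bowen_ball_le n x e e' : e <= e' -> bowen_ball f n x e `<=` bowen_ball f n x e'.
Proof. by move=> ee y Hy i ni; apply: lt_le_trans (Hy i ni) ee. Qed.

(** Uniform continuity of an approximation psi of Phi bounds the variation of
    its Birkhoff sums on Bowen balls. *)
Lemma bounded_distortion rho : 0 < rho -> exists2 eps, 0 < eps &
  \forall n \near \oo, forall x y, bowen_ball f n x eps y ->
    `|Phi n y - Phi n x| <= rho * n%:R.
Proof.
move=> rho0; have r3 : 0 < rho / 3 by lra.
have [psi cpsi H] := asymptotically_additive_approx hPhi r3.
have [eps eps0 Heps] := continuous_compact_mdist hX cpsi r3.
exists eps => //; apply: filterS H => n H x y xy.
have hb : `|birkhoff_sum f psi n y - birkhoff_sum f psi n x| <= rho / 3 * n%:R.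
  rewrite /birkhoff_sum -sumrB; apply: le_trans (ler_norm_sum _ _ _) _.
  rewrite mulr_natr -[n in leRHS]card_ord -sumr_const; apply: ler_sum => i _.
  by rewrite distrC; apply/ltW/Heps/xy.
have := H x; have := H y; move: hb; set p := birkhoff_sum _ _ _ _.
set q := birkhoff_sum _ _ _ _; set a := _ * n%:R; rewrite !ler_norml.
have -> : rho * n%:R = 3 * a by rewrite /a; lra.
by move=> /andP[? ?] /andP[? ?] /andP[? ?]; apply/andP; split; lra.
Qed.

Lemma Phi_bounded n : (0 < n)%N -> exists B, forall x, `|Phi n x| <= B.
Proof. by move=> n0; apply: continuous_bounded => //; exact: hPhi.1. Qed.

Lemma sup_bowen_ge n x eps y : (0 < n)%N -> bowen_ball f n x eps y ->
  Phi n y <= sup (Phi n @` bowen_ball f n x eps).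
Proof.
move=> n0 xy; have [B HB] := Phi_bounded n0.
apply: sup_ubound; last by exists y.
by exists B => _ [z _ <-]; exact: le_trans (ler_norm _) (HB z).
Qed.

Lemma sup_bowen_le n x eps M : 0 < eps ->
  (forall y, bowen_ball f n x eps y -> Phi n y <= M) ->
  sup (Phi n @` bowen_ball f n x eps) <= M.
Proof.
move=> e0 H; apply: sup_le_ub; first by exists (Phi n x), x => //; exact: bowen_ball_center.
by move=> _ [y xy <-]; exact: H.
Qed.

Lemma pressure_sum_ge0 alpha eps G : (0 <= pressure_sum f Phi alpha eps G)%E.
Proof. by apply: esum_ge0 => q _; rewrite lee_fin expR_ge0. Qed.

Lemma pressure_pre_ge0 Z alpha eps N : (0 <= pressure_pre f Z alpha eps N Phi)%E.
Proof. by apply: le_ereal_inf_tmp => _ [G _ <-]; exact: pressure_sum_ge0. Qed.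

Lemma nondecreasing_pressure_pre Z alpha eps :
  nondecreasing_seq (fun N => pressure_pre f Z alpha eps N Phi).
Proof.
move=> N M NM; apply: ereal_inf_le_tmp => _ [G [cG GN ZG] <-].
exists G => //; split => // q Gq; have /andP[-> h] := GN q Gq.
exact: leq_trans NM h.
Qed.

Lemma pressure_outer_eq0 Z alpha eps :
  pressure_outer f Z alpha eps Phi = 0%E <->
  forall N, (pressure_pre f Z alpha eps N Phi <= 0)%E.
Proof.
have nd := nondecreasing_pressure_pre Z alpha eps.
have cv := ereal_nondecreasing_cvgn nd.
rewrite /pressure_outer (cvg_lim _ cv) //; split=> [s0 N|H].
  by rewrite -s0; apply: ereal_sup_ubound; exists N.
apply/eqP; rewrite eq_le; apply/andP; split.
  by apply: ge_ereal_sup => _ [N _ <-]; exact: H.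
by apply: le_trans (pressure_pre_ge0 Z alpha eps 0) _; apply: ereal_sup_ubound; exists 0%N.
Qed.

Lemma pressure_at_setS Z Z' eps : Z `<=` Z' ->
  (pressure_at f Z Phi eps <= pressure_at f Z' Phi eps)%E.
Proof.
move=> ZZ'; apply: ereal_inf_le_tmp => _ [alpha H0 <-]; exists alpha; last reflexivity.
move/pressure_outer_eq0 : H0 => H0; apply/pressure_outer_eq0 => N.
apply: le_trans (H0 N); apply: ereal_inf_le_tmp => _ [G [cG GN ZG] <-].
by exists G => //; split => //; exact: subset_trans ZG.
Qed.

(** A cover by balls of radius e' is a cover by the concentric balls of radius e,
    on which the suprema of Phi n increase by at most rho * n; replacing alpha
    by alpha + rho compensates for this. *)
Lemma pressure_at_almost_monotone Z rho : 0 < rho ->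
  exists2 e0, 0 < e0 & forall e e', 0 < e' -> e' <= e -> e < e0 ->
  (pressure_at f Z Phi e <= pressure_at f Z Phi e' + rho%:E)%E.
Proof.
move=> rho0; have [e0 e00 [N0 _ HN0]] := bounded_distortion rho0.
exists e0 => // e e' e'0 ee' ee0; rewrite -leeBlDr //.
apply: le_ereal_inf_tmp => _ [alpha H0 <-]; rewrite leeBlDr // -EFinD.
apply: ereal_inf_lbound; exists (alpha + rho); last reflexivity.
move/pressure_outer_eq0 : H0 => H0; apply/pressure_outer_eq0 => N.
apply: le_trans (nondecreasing_pressure_pre _ _ _ (leq_maxl N N0)) _.
apply: le_trans (H0 (maxn N N0)); apply: le_ereal_inf_tmp => _ [G [cG GN ZG] <-].
apply: ge_ereal_inf; exists (pressure_sum f Phi (alpha + rho) e G).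
  exists G => //; split => //; apply: subset_trans ZG _.
  by apply: subset_bigcup => q _; exact: bowen_ball_le.
apply: le_esum => -[x n] /GN /= /andP[n0]; rewrite geq_max => /andP[_ n1].
rewrite lee_fin ler_expR.
suff : sup (Phi n @` bowen_ball f n x e) <=
    sup (Phi n @` bowen_ball f n x e') + rho * n%:R.
  rewrite opprD mulrDl; set s := sup _; set s' := sup _.
  by rewrite mulNr => h; rewrite mulNr; lra.
apply: sup_bowen_le => [|y xy]; first exact: lt_le_trans ee'.
have := sup_bowen_ge n0 (@bowen_ball_center n x _ e'0).
have := HN0 n n1 x y (bowen_ball_le (ltW ee0) xy); rewrite ler_norml => /andP[_ h1] h2.
by set s' := sup _ in h2 *; set a := rho * _ in h1 *; lra.
Qed.

Lemma pressure_cvg Z : pressure_at f Z Phi e @[e --> 0^'+] --> pressure f Z Phi.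
Proof. by apply: almost_nonincreasing_cvg => rho; exact: pressure_at_almost_monotone. Qed.

Lemma pressure_setS Z Z' : Z `<=` Z' -> (pressure f Z Phi <= pressure f Z' Phi)%E.
Proof.
move=> ZZ'; apply: (lee_cvg_to (@pressure_cvg Z) (@pressure_cvg Z')).
by apply: nearW => e; exact: pressure_at_setS.
Qed.

Lemma pressure_gt (c : R) : (c%:E < pressure f [set: X] Phi)%E ->
  \forall e \near 0^'+, exists2 N, (0 < N)%N &
    (0 < pressure_pre f [set: X] c e N Phi)%E.
Proof.
move=> cP; have : \forall e \near 0^'+, (c%:E < pressure_at f [set: X] Phi e)%E.
  apply: (@pressure_cvg [set: X] [set y | (c%:E < y)%E]).
  by apply: open_nbhs_nbhs; split => //; exact: open_ereal_gt_ereal.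
apply: filterS => e; apply: contraPP => no; apply/negP; rewrite -leNgt.
apply: ereal_inf_lbound; exists c; last reflexivity.
apply/pressure_outer_eq0 => N.
apply: le_trans (nondecreasing_pressure_pre _ _ _ (leqnSn N)) _.
by rewrite leNgt; apply/negP => h; apply: no; exists N.+1.
Qed.

End PressureBasics.

(** * The variational principle *)

Section ShannonLimit.
Variable R : realType.

(** Upper semicontinuity follows from the Gibbs inequality applied with a
    strictly positive perturbation of the limit law, so that the logarithms are
    evaluated at constants. *)
Lemma shannon_usc (I : Type) (U : set_system I) (T : finType) (p : I -> T -> R)
    (p0 : T -> R) (e : R) : ProperFilter U -> 0 < e ->
  (forall i t, 0 <= p i t) -> (forall i, \sum_t p i t = 1) ->
  (forall t, 0 <= p0 t) -> \sum_t p0 t = 1 ->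
  (forall t, p i t @[i --> U] --> p0 t) ->
  \forall i \near U, shannon (p i) <= shannon p0 + e.
Proof.
move=> UU e0 pi0 pi1 p00 p01 cp; have T0 := card_gt0_sum1 p01.
have T0' : 0 < #|T|%:R :> R by rewrite ltr0n.
(* Since q >= (1 - s) p0, where p0 > 0 the number - ln q exceeds - ln p0 by at
   most - ln (1 - s) = e / 2. *)
pose s := 1 - expR (- (e / 2)).
have s1 : 0 < 1 - s by rewrite /s opprB addrC subrK expR_gt0.
have s0 : 0 < s by rewrite subr_gt0 expR_lt1; lra.
have lns : ln (1 - s) = - (e / 2) by rewrite /s opprB addrC subrK expRK.
pose q t := (1 - s) * p0 t + s / #|T|%:R.
have q0 t : 0 < q t.
  by apply: ltr_wpDl; [rewrite mulr_ge0 // ltW|rewrite divr_gt0].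
have q1 : \sum_t q t = 1.
  rewrite big_split /= -mulr_sumr p01 sumr_const -[_ *+ _]mulr_natr divfK ?gt_eqF //.
  by rewrite mulr1 subrK.
have lim : (- \sum_t p i t * ln (q t)) @[i --> U] --> - \sum_t p0 t * ln (q t).
  apply: cvgN; apply: cvg_big => [|t _]; first exact: add_continuous.
  by apply: cvgMl; exact: cp.
have bound : - \sum_t p0 t * ln (q t) <= shannon p0 + e / 2.
  have key : \sum_t p0 t * ln (p0 t) - \sum_t p0 t * ln (q t) <= e / 2.
    rewrite -sumrB -[leRHS]mul1r -[X in _ <= X * _]p01 mulr_suml; apply: ler_sum => t _.
    rewrite -mulrBr; have [->|pt0] := eqVneq (p0 t) 0; first by rewrite !mul0r.
    have pt : 0 < p0 t by rewrite lt_neqAle eq_sym pt0 p00.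
    rewrite ler_pM2l // lerBlDl -lerBlDr -lns -lnM ?posrE //.
    rewrite ler_ln ?posrE ?mulr_gt0 // mulrC lerDl divr_ge0 //; exact: ltW.
  by rewrite /shannon; lra.
have /cvgrPdist_le/(_ (e / 2)) := lim.
rewrite divr_gt0 // => /(_ isT); apply: filterS => i.
rewrite ler_norml => /andP[h _].
have := @gibbs R T (p i) q (pi0 i) (fun t => ltW (q0 t)) _ _.
rewrite q1 pi1 lexx => /(_ _ isT) g; apply: le_trans (g _) _; last lra.
by move=> t qt; have := q0 t; rewrite qt ltxx.
Qed.

End ShannonLimit.

Section SeparatedSets.
Variables (R : realType) (X : pointedMetricType R) (f : X -> X).
Hypothesis hX : compact [set: X].

(** Two points with the same itinerary through cells of diameter less than eps
    lie in a common Bowen ball, so separated sets have bounded cardinality; a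
    largest one is spanning, for otherwise a point could be added to it. *)
Lemma maximal_separated (n : nat) (eps : R) : 0 < eps -> exists s : seq X,
  [/\ uniq s,
      forall x y, x \in s -> y \in s -> bowen_ball f n x eps y -> x = y &
      forall y, exists2 x, x \in s & bowen_ball f n x eps y].
Proof.
move=> e0; pose sep (s : seq X) := uniq s /\
  forall x y, x \in s -> y \in s -> bowen_ball f n x eps y -> x = y.
have [k [xi [_ dxi]]] := fine_labelling_ex (dirac (point : borel X)) hX e0.
have bnd s : sep s -> (size s <= #|{ffun 'I_n -> 'I_k}|)%N.
  move=> [us ss]; rewrite -(size_map (partition_join f xi n)).
  suff /card_uniqP <- : uniq (map (partition_join f xi n) s) by exact: max_card.
  rewrite map_inj_in_uniq // => x y xs ys /ffunP exy; apply: ss => // i ni.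
  by have := exy (Ordinal ni); rewrite !ffunE; exact: dxi.
pose P m := `[< exists2 s, sep s & size s = m >].
have exP : exists m, P m by exists 0%N; apply/asboolP; exists [::].
have [|m /asboolP[s [us ss] sm] maxm] := @ex_maxnP P #|{ffun 'I_n -> 'I_k}| exP.
  by move=> m /asboolP[s seps <-]; exact: bnd.
exists s; split => // y; apply: contrapT => no.
have ys : y \notin s by apply/negP => ys; apply: no; exists y => // i _; rewrite mdistxx.
have : P (size (y :: s)).
  apply/asboolP; exists (y :: s) => //; split; first by rewrite /= ys.
  move=> a b; rewrite !inE => /orP[/eqP ->|as_] /orP[/eqP ->|bs] // H.
  - by exfalso; apply: no; exists b => // i ni; rewrite metric_sym; exact: H.
  - by exfalso; apply: no; exists a.
  - exact: ss.
by move/maxm; rewrite /= sm ltnn.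
Qed.

Lemma pressure_pre_le_sum Phi (c eps : R) (N n : nat) (s : seq X) :
  uniq s -> (0 < n)%N -> (N <= n)%N ->
  (forall y, exists2 x, x \in s & bowen_ball f n x eps y) ->
  (pressure_pre f [set: X] c eps N Phi <=
   (\sum_(x <- s) expR (- c * n%:R + sup (Phi n @` bowen_ball f n x eps)))%:E)%E.
Proof.
move=> us n0 Nn cov; pose r := [seq (x, n) | x <- s].
have ur : uniq r by rewrite map_inj_uniq // => x y [].
apply: ge_ereal_inf; exists (pressure_sum f Phi c eps [set` r]).
  exists [set` r] => //; split.
  - exact: finite_set_countable.
  - by move=> q /= /mapP[x _ ->] /=; rewrite n0.
  - move=> y _; have [x xs xy] := cov y; exists (x, n) => //=.
    by apply/mapP; exists x.
rewrite /pressure_sum esum_fset; last 2 first.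
- exact: finite_seq.
- by move=> q _; rewrite lee_fin expR_ge0.
by rewrite -fsbig_seq // big_map sumEFin.
Qed.

End SeparatedSets.

Section GibbsWeights.
Variable R : realType.

(** The weights are exp (S i) / Z, where Z is the sum on the right: minus the
    logarithm of a weight is ln Z - S i, and averaging gives ln Z. *)
Lemma gibbs_weights (n : nat) (S : 'I_n.+1 -> R) : exists w : 'I_n.+1 -> R,
  [/\ forall i, 0 <= w i, \sum_i w i = 1 &
      shannon w + \sum_i w i * S i = ln (\sum_i expR (S i))].
Proof.
pose Z := \sum_i expR (S i).
have Z0 : 0 < Z.
  rewrite /Z big_ord_recl; apply: ltr_pwDl; first exact: expR_gt0.
  by apply: sumr_ge0 => i _; exact: expR_ge0.
pose w i := expR (S i) / Z.
have w1 : \sum_i w i = 1 by rewrite -mulr_suml mulfV // gt_eqF.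
exists w; split => //; first by move=> i; rewrite divr_ge0 ?expR_ge0 // ltW.
rewrite /shannon -[RHS]mul1r -w1 mulr_suml -sumrN -big_split /=.
apply: eq_bigr => i _; rewrite {2}/w ln_div ?posrE ?expR_gt0 // expRK; ring.
Qed.

End GibbsWeights.

Section WeightedEmpirical.
Variables (R : realType) (X : pointedMetricType R) (f : X -> X).
Hypotheses (hX : compact [set: X]) (hf : continuous f).

(** Misiurewicz's construction: weights proportional to exp (S_n psi) on a
    separated set, spread along the orbits. A labelling of small diameter
    separates the points by their words of length n.+1, so the entropy of the
    words is that of the weights. Averaging over blocks of length q bounds it
    by the mean of the entropies of the q-words read from time m on, which by
    concavity is at most the entropy of the q-words under the average of the
    shifted measures, that is, under nu. The labelling is quantified after nu
    because it has to be adapted to a limit of such measures. *)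
Lemma weighted_empirical (n : nat) (s : seq X) (eps : R) (psi : X -> R) :
  uniq s -> s != [::] ->
  (forall x y, x \in s -> y \in s -> bowen_ball f n.+1 x eps y -> x = y) ->
  continuous psi -> exists nu : probability (borel X) R,
  (forall A : set (borel X), measurable A ->
     `|fine (nu (f @^-1` A)) - fine (nu A)| <= n.+1%:R^-1) /\
  forall (k : nat) (xi : X -> 'I_k), measurable_label xi ->
    (forall x y, xi x = xi y -> mdist x y < eps) -> forall q, (0 < q)%N ->
    q%:R * ln (\sum_(x <- s) expR (birkhoff_sum f psi n.+1 x)) <=
    n.+1%:R * partition_entropy nu (partition_join f xi q) +
    2 * q%:R ^+ 2 * ln k%:R + q%:R * (n.+1%:R * \int[nu]_x psi x).
Proof.
case: s => [//|x0 s0]; set s := x0 :: s0 => us _ sep cpsi.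
pose e (i : 'I_(size s0).+1) := nth x0 s i.
have es i : e i \in s by apply: mem_nth.
have [w [w0 w1 wE]] := gibbs_weights (fun i => birkhoff_sum f psi n.+1 (e i)).
have sumE : \sum_(x <- s) expR (birkhoff_sum f psi n.+1 x) =
    \sum_i expR (birkhoff_sum f psi n.+1 (e i)).
  by rewrite (big_nth x0) big_mkord.
have [nu mix] := mixture_ex (fun i => empirical f (e i) n) w0 w1.
exists nu; split.
  move=> A mA; have mfA := measurable_preimage hf mA.
  rewrite (mix _ mA) (mix _ mfA) -sumrB; apply: le_trans (ler_norm_sum _ _ _) _.
  rewrite -[leRHS]mul1r -[X in _ <= X * _]w1 mulr_suml; apply: ler_sum => i _.
  rewrite -mulrBr normrM (ger0_norm (w0 i)); apply: ler_wpM2l; first exact: w0.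
  exact: empirical_defect.
move=> k xi mxi dxi q q0.
have k0 : (0 < k)%N by case: (k) (xi point) => [[]|].
have intnu : n.+1%:R * \int[nu]_x psi x = \sum_i w i * birkhoff_sum f psi n.+1 (e i).
  rewrite (mixture_Rintegral hX w0 w1 mix cpsi) mulr_sumr; apply: eq_bigr => i _.
  by rewrite empirical_Rintegral // mulrCA; congr (_ * _); rewrite mulrC divfK // pnatr_eq0.
pose word m l i := partition_join f xi l (iter m f (e i)).
pose a m l := shannon (law w (word m l)).
have blocks : q%:R * a 0%N n.+1 <= \sum_(m < n.+1) a m q + 2 * q%:R ^+ 2 * ln k%:R.
  apply: block_averaging => //.
  - move=> m l1 l2 _; pose h (t : {ffun 'I_l1 -> 'I_k}) (u : {ffun 'I_l2 -> 'I_k}) :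
        {ffun 'I_(l1 + l2) -> 'I_k} :=
      [ffun i : 'I_(l1 + l2) => match fintype.split i with inl b => t b | inr b => u b end].
    apply: (@shannon_join R _ w w0 w1 _ _ _ _ _ _ h) => i.
    apply/ffunP => j; rewrite !ffunE; case: fintype.splitP => b jb; rewrite !ffunE jb //.
    by rewrite addnC -!iterD; congr (xi (iter _ _ _)); lia.
  - move=> m l _; apply: le_trans (shannon_le_ln_card _ _) _.
    + by move=> t; exact: law_ge0.
    + exact: law_sum1.
    + by rewrite card_ffun !card_ord natrX lnXn ?ltr0n // mulr_natl.
  - by move=> m l; apply: shannon_ge0 => t; rewrite law_ge0 // law_le1.
  - by apply: ln_ge0; rewrite ler1n.
have aw : a 0%N n.+1 = shannon w.
  apply: shannon_law_inj => i j /ffunP ij.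
  have eij : e i = e j.
    apply: sep => // m mn; have := ij (Ordinal mn); rewrite !ffunE; exact: dxi.
  apply/val_inj/eqP; rewrite -(@nth_uniq _ x0 s _ _ (ltn_ord i) (ltn_ord j) us).
  by apply/eqP; exact: eij.
have avg : \sum_(m < n.+1) a m q <= n.+1%:R * partition_entropy nu (partition_join f xi q).
  have n0 : 0 < n.+1%:R :> R by rewrite ltr0n.
  rewrite -ler_pdivrMl // mulr_sumr.
  apply: le_trans (@shannon_mixture R _ _ (fun=> n.+1%:R^-1)
    (fun m : 'I_n.+1 => law w (word m q)) _ _ _ _) _.
  - by move=> m; rewrite invr_ge0.
  - by move=> m t; exact: law_ge0.
  - by move=> m m'; rewrite !law_sum1.
  - by rewrite sumr_const card_ord -[_ *+ _]mulr_natr mulVf // gt_eqF.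
  rewrite partition_entropyE le_eqVlt; apply/orP; left; apply/eqP; congr shannon.
  apply/funext => t; rewrite mix; last exact: measurable_join.
  transitivity (\sum_i \sum_(m < n.+1)
      n.+1%:R^-1 * (if word m q i == t then w i else 0)).
    by rewrite exchange_big; apply: eq_bigr => m _; rewrite /law big_mkcond mulr_sumr.
  apply: eq_bigr => i _.
  rewrite (empirical_mixture f (e i) n (@measurable_join R X f hf _ xi q mxi t)) mulr_sumr.
  apply: eq_bigr => m _; rewrite mulrCA; congr (_ * _); rewrite /= indicE.
  case: eqP => wt; first by rewrite mem_set // mulr1.
  by rewrite memNset ?mulr0.
have wE' : ln (\sum_(x <- s) expR (birkhoff_sum f psi n.+1 x)) =
    shannon w + n.+1%:R * \int[nu]_x psi x by rewrite sumE -wE intnu.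
rewrite wE' mulrDr lerD2r -aw; apply: le_trans blocks _.
by rewrite lerD2r.
Qed.

End WeightedEmpirical.

Section VariationalPrinciple.
Variables (R : realType) (X : pointedMetricType R) (f : X -> X).
Hypotheses (hX : compact [set: X]) (hf : continuous f).
Variable Phi : nat -> X -> R.
Hypothesis hPhi : asymptotically_additive f Phi.

(** The balls centred at the points of a spanning set form a cover, so the sum
    over it is bounded below by the positive number pressure_pre; distortion and
    approximation each cost d per unit of time. *)
Lemma separated_sum_growth (c d : R) : (c%:E < pressure f [set: X] Phi)%E -> 0 < d ->
  exists eps b : R, [/\ 0 < eps, 0 < b &
  forall psi, continuous psi ->
    (\forall n \near \oo, forall x, `|Phi n x - birkhoff_sum f psi n x| <= d * n%:R) ->
    \forall n \near \oo, forall s : seq X, uniq s ->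
      (forall y, exists2 x, x \in s & bowen_ball f n x eps y) ->
      ln b + (c - 2 * d) * n%:R <= ln (\sum_(x <- s) expR (birkhoff_sum f psi n x))].
Proof.
move=> cP d0; have [eps1 eps10 H2] := bounded_distortion hX hPhi d0.
have [eps [eps0 epsle [N N0 preN]]] : exists eps, [/\ 0 < eps, eps <= eps1 &
    exists2 N, (0 < N)%N & (0 < pressure_pre f [set: X] c eps N Phi)%E].
  have HP := pressure_gt hX hPhi cP.
  near (0 : R)^'+ => eps; exists eps; split.
  - by near: eps; exact: nbhs_right_gt.
  - by near: eps; exact: nbhs_right_le.
  - by near: eps; exact: HP.
have [b b0 bpre] : exists2 b : R, 0 < b & (b%:E <= pressure_pre f [set: X] c eps N Phi)%E.
  case: (pressure_pre _ _ _ _ _ _) preN => [r| |] //; last by exists 1 => //; rewrite leey.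
  by rewrite lte_fin => r0; exists r.
exists eps, b; split => // psi cpsi H1; near=> n => s us cov.
have Nn : (N <= n)%N by near: n; exact: nbhs_infty_ge.
have n0 : (0 < n)%N by exact: leq_trans Nn.
have h1 : forall x, `|Phi n x - birkhoff_sum f psi n x| <= d * n%:R by near: n; exact: H1.
have h2 : forall x y, bowen_ball f n x eps1 y -> `|Phi n y - Phi n x| <= d * n%:R.
  by near: n; exact: H2.
pose Z := \sum_(x <- s) expR (birkhoff_sum f psi n x).
have Zge : b <= expR (- ((c - 2 * d) * n%:R)) * Z.
  rewrite -lee_fin; apply: le_trans bpre _.
  apply: le_trans (pressure_pre_le_sum _ _ us n0 Nn cov) _.
  rewrite lee_fin /Z mulr_sumr; apply: ler_sum => x _.
  rewrite -expRD ler_expR.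
  have : sup (Phi n @` bowen_ball f n x eps) <= birkhoff_sum f psi n x + 2 * (d * n%:R).
    apply: sup_bowen_le => // y xy.
    have := h2 x y (bowen_ball_le epsle xy); have := h1 x.
    rewrite !ler_norml => /andP[_ ?] /andP[_ ?].
    by lra.
  by set sp := sup _; set a := d * n%:R; rewrite (_ : (c - 2 * d) * n%:R = c * n%:R - 2 * a);
    [rewrite mulNr; lra|rewrite /a; ring].
have Z0 : 0 < Z.
  have := lt_le_trans b0 Zge; by rewrite pmulr_rgt0 // expR_gt0.
have : ln b <= ln (expR (- ((c - 2 * d) * n%:R)) * Z).
  by rewrite ler_ln ?posrE // mulr_gt0 // expR_gt0.
rewrite lnM ?posrE ?expR_gt0 // expRK; lra.
Unshelve. all: by end_near. Qed.

(** The half of the variational principle that constructs measures. The measures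
    nu n of weighted_empirical have a limit mu along an ultrafilter, and the
    labelling is chosen with cells that are continuity sets for mu. For fixed q,
    divide the inequality of weighted_empirical by q * n.+1 and pass to the
    limit: the entropy of the q-words passes to the limit by shannon_usc, the
    integral of psi by weak convergence. Since the entropy of mu is an infimum
    over q, the bound for all q is enough. *)
Lemma variational_bound (c : R) : (c%:E < pressure f [set: X] Phi)%E ->
  exists (mu : probability (borel X) R) (k : nat) (xi : X -> 'I_k) (h : R),
  [/\ invariant_measures f mu, measurable_label xi,
      entropy_of_partition f mu xi = h%:E & c < h + mean_value Phi mu].
Proof.
move=> cP.
have [c0 cc0 c0P] : exists2 c0 : R, c < c0 & (c0%:E < pressure f [set: X] Phi)%E.
  case: (pressure _ _ _) cP => [p| |] //; last by exists (c + 1); [lra|exact: ltry].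
  by rewrite lte_fin => cp; exists ((c + p) / 2); rewrite ?lte_fin; lra.
pose d := (c0 - c) / 4; have d0 : 0 < d by rewrite /d; lra.
have [psi cpsi H1] := asymptotically_additive_approx hPhi d0.
have [eps [b [eps0 b0 grow]]] := separated_sum_growth c0P d0.
have [M _ HM] := grow psi cpsi H1.
have step n : exists nu : probability (borel X) R,
    (forall A : set (borel X), measurable A ->
       `|fine (nu (f @^-1` A)) - fine (nu A)| <= n.+1%:R^-1) /\
    ((M <= n)%N -> forall (k : nat) (xi : X -> 'I_k), measurable_label xi ->
      (forall x y, xi x = xi y -> mdist x y < eps) -> forall q, (0 < q)%N ->
      q%:R * (ln b + (c0 - 2 * d) * n.+1%:R) <=
      n.+1%:R * partition_entropy nu (partition_join f xi q) +
      2 * q%:R ^+ 2 * ln k%:R + q%:R * (n.+1%:R * \int[nu]_x psi x)).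
  have [s [us sep cov]] := maximal_separated f hX n.+1 eps0.
  have s0 : s != [::].
    by have [x xs _] := cov point; apply/eqP => s0; rewrite s0 in xs.
  have [nu [nu1 nu2]] := weighted_empirical hX hf us s0 sep cpsi.
  exists nu; split => // Mn k xi mxi dxi q q0.
  apply: le_trans (nu2 k xi mxi dxi q q0); rewrite ler_pM2l ?ltr0n //.
  by apply: HM => //=; exact: leqW.
have [nu Hnu] := choice step.
have [U [UU Uoo]] := ultraFilterLemma (eventually_filter : ProperFilter \oo).
have [mu [imu cset cint]] := @invariant_limit R X f hX hf U nu UU Uoo
  (fun n => (Hnu n).1).
have [k [xi [cxi dxi]]] := fine_labelling_ex mu hX eps0.
have mxi : measurable_label xi by move=> i; exact: (cxi i).1.
have [h [hE _ _ hle]] := entropy_of_partition_cvg hf imu mxi.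
exists mu, k, xi, h; split => //.
have key : c0 - 2 * d - \int[mu]_x psi x <= h.
  apply: hle => q q0; apply/ler_addgt0Pr => e e0.
  have e3 : 0 < e / 3 by lra.
  have q0' : 0 < q%:R :> R by rewrite ltr0n.
  have q1 : 1 <= q%:R :> R by rewrite ler1n.
  have mj := @measurable_join R X f hf _ xi q mxi.
  have cj : forall t, continuity_set mu (partition_join f xi q @^-1` [set t]).
    apply: join_cells => //.
    - exact: continuity_setT.
    - by move=> A B; exact: continuity_setI.
    - by move=> A; exact: continuity_set_preimage.
  have near1 : \forall n \near U, partition_entropy (nu n) (partition_join f xi q) <=
      partition_entropy mu (partition_join f xi q) + e / 3.
    apply: (@shannon_usc R _ U _
      (fun n t => fine (nu n (partition_join f xi q @^-1` [set t])))) => //.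
    - by move=> n t; exact: fine_ge0.
    - by move=> n; exact: label_sum1.
    - by move=> t; exact: fine_ge0.
    - exact: label_sum1.
    - by move=> t; exact: cset.
  have /cvgrPdist_le/(_ _ e3) near2 := cint psi cpsi.
  pose D := 2 * q%:R * ln k%:R - ln b.
  have near3 : \forall n \near U, D * n.+1%:R^-1 <= e / 3.
    have lim : (D * n.+1%:R^-1) @[n --> \oo] --> (D * 0 : R).
      by apply: cvgMr; exact: cvg_harmonic.
    have /cvgrPdist_le/(_ _ e3)/Uoo := lim; apply: filterS => n.
    by rewrite mulr0 sub0r normrN ler_norml => /andP[].
  have near4 : U [set n | (M <= n)%N] by apply: Uoo; exact: nbhs_infty_ge.
  have [n [[E1 E2] [E3 E4]]] := @filter_ex _ U _ _
    (filterI (filterI near1 near2) (filterI near3 near4)).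
  have n0 : 0 < n.+1%:R :> R by rewrite ltr0n.
  have := (Hnu n).2 E4 k xi mxi dxi q q0.
  clear near1 near2 near3 near4.
  move: E1 E2 E3; set Hn := partition_entropy (nu n) _; set Hm := partition_entropy mu _.
  set In := Rintegral (nu n) _ _; set Im := Rintegral mu _ _.
  set N := (n.+1%:R : R) in n0 *; set Q := (q%:R : R) in q0' q1 D *.
  move=> E1 /=; rewrite ler_norml => /andP[E2 _] E3 main.
  have main' : c0 - 2 * d <= Hn / Q + D / N + In.
    rewrite -(ler_pM2l (mulr_gt0 q0' n0)).
    rewrite (_ : Q * N * (Hn / Q + D / N + In) =
      N * Hn + 2 * Q ^+ 2 * ln k%:R + Q * (N * In) - Q * ln b); last first.
      by rewrite /D; field; rewrite !gt_eqF.
    by rewrite mulrDr in main; lra.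
  have E1' : Hn / Q <= Hm / Q + e / 3.
    rewrite ler_pdivrMr // mulrDl divfK ?gt_eqF //; apply: le_trans E1 _.
    by rewrite lerD2l ler_peMr // ltW.
  move: main' E1' E2 E3; clearbody D N Q Hn Hm In Im => main' E1' E2 E3.
  by move: main' E1' E2 E3; set x := _ / N; set y := Hn / Q; set z := Hm / Q; lra.
have := mean_value_dist hX hf hPhi imu cpsi H1; rewrite ler_norml => /andP[h1 _].
have dE : 4 * d = c0 - c by rewrite /d; lra.
move: key h1; set J := Rintegral _ _ _; set m := mean_value _ _.
by clearbody d J m; lra.
Unshelve. all: by end_near. Qed.

End VariationalPrinciple.

(** * Contracted copies of the simplex of invariant measures *)

Section Homothety.
Variables (R : realType) (X : pointedMetricType R) (f : X -> X).
Hypotheses (hX : compact [set: X]) (hf : continuous f).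
Implicit Types (mu nu lam : probability (borel X) R).

Lemma mixture2_invariant t mu nu lam : is_mixture2 t mu nu lam ->
  invariant_measures f mu -> invariant_measures f nu -> invariant_measures f lam.
Proof.
move=> mix imu inu A mA; have mfA := measurable_preimage hf mA.
rewrite -[LHS]fineK ?fin_num_measure // -[RHS]fineK ?fin_num_measure //.
by rewrite (mix _ mA) (mix _ mfA) imu // inu.
Qed.

Variables (mu : probability (borel X) R) (th : R).
Hypotheses (imu : invariant_measures f mu) (th01 : 0 <= th <= 1).

(** A compact convex set of measures that still separates mean values as well as
    the set of all invariant measures does, while for small th the sum of entropy
    and mean value remains on it almost as large as at mu. *)
Definition homothety : set (borel_prob X) :=
  [set lam | exists2 nu : probability (borel X) R,
     invariant_measures f nu & is_mixture2 th mu nu lam].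

Lemma homothety_center : homothety mu.
Proof. by exists mu => // A mA; rewrite -mulrDl subrK mul1r. Qed.

Lemma homothety_borel_closed : borel_closed homothety.
Proof.
move=> lam lam' eqA [nu inu mix]; exists nu => // A mA.
by rewrite -(mix A mA) eqA.
Qed.

Lemma homothety_invariant : homothety `<=` @invariant_measures R X f.
Proof. by move=> lam [nu inu mix]; exact: mixture2_invariant mix imu inu. Qed.

(** An ultrafilter on the contracted set lifts to one on the invariant measures,
    along a choice of preimages. *)
Lemma homothety_compact : compact homothety.
Proof.
rewrite compact_ultra => U UU UK.
have hs (lam : borel_prob X) : exists nu : borel_prob X, homothety lam ->
    invariant_measures f nu /\ is_mixture2 th mu nu lam.
  by have [[nu inu mix]|nK] := pselect (homothety lam); [exists nu|exists lam].
have [s Hs] := choice hs.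
have := @compact_invariant_measures R X f hX hf; rewrite compact_ultra.
move=> /(_ _ (ultra_fmap s UU))[].
  by apply: (@filterS _ U _ _ _ _ UK) => lam /Hs[].
move=> nu0 [inu0 cvs].
have [lam0 mix0] := mixture2_ex mu nu0 th01.
exists lam0; split; first by exists nu0.
apply: (@cvg_borel_prob R X _ U id) => phi cphi.
rewrite (mixture2_Rintegral hX th01 mix0 cphi).
have cphis : (\int[s lam]_x phi x) @[lam --> U] --> \int[nu0]_x phi x.
  exact: (cvg_comp _ _ cvs (@weak_eval_continuous R X phi cphi nu0)).
have : ((1 - th) * \int[mu]_x phi x + th * \int[s lam]_x phi x) @[lam --> U] -->
    (1 - th) * \int[mu]_x phi x + th * \int[nu0]_x phi x.
  by apply: cvgD; [exact: cvg_cst|exact: cvgMr].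
apply: cvg_trans; apply: near_eq_cvg; apply: (@filterS _ U _ _ _ _ UK) => lam Klam.
by rewrite (mixture2_Rintegral hX th01 (Hs lam Klam).2 cphi).
Qed.

(** The path from mu to lam takes the values mu and lam themselves at its ends,
    since a mixture of weight 0 or 1 is determined only on Borel sets. *)
Lemma homothety_segment lam : homothety lam -> exists C : set (borel_prob X),
  [/\ connected C, C mu, C lam & C `<=` homothety].
Proof.
move=> [nu inu mix].
have hg (t : R) : exists g : borel_prob X, [/\ t = 0 -> g = mu, t = 1 -> g = lam &
    0 <= t <= 1 -> is_mixture2 t mu lam g].
  have [->|t0] := eqVneq t 0.
    exists mu; split => // [/eqP|_ A mA]; first by rewrite eq_sym oner_eq0.
    by rewrite subr0 mul1r mul0r addr0.
  have [->|t1] := eqVneq t 1.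
    exists lam; split => // [/eqP|_ A mA]; first by rewrite oner_eq0.
    by rewrite subrr mul0r add0r mul1r.
  have [t01|nt] := boolP (0 <= t <= 1).
    have [g Hg] := mixture2_ex mu lam t01.
    by exists g; split => // /eqP; rewrite ?(negbTE t0) ?(negbTE t1).
  by exists mu; split => // /eqP; rewrite ?(negbTE t0) ?(negbTE t1).
have [g Hg] := choice hg.
exists (g @` `[0, 1]); split.
- apply: connected_continuous_connected; first exact: segment_connected.
  apply/subspace_continuousP => t; rewrite /= in_itv /= => t01.
  apply: cvg_borel_prob => phi cphi; have [_ _ mt] := Hg t.
  rewrite (mixture2_Rintegral hX t01 (mt t01) cphi).
  have : ((1 - u) * \int[mu]_x phi x + u * \int[lam]_x phi x)
      @[u --> within `[0, 1] (nbhs t)] -->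
      (1 - t) * \int[mu]_x phi x + t * \int[lam]_x phi x.
    have ct : (u : R) @[u --> within `[0, 1] (nbhs t)] --> t by exact: cvg_within.
    apply: cvgD; apply: cvgMl => //.
    by apply: cvgB => //; exact: cvg_cst.
  apply: cvg_trans; apply: near_eq_cvg.
  rewrite near_withinE; apply: nearW => u; rewrite /= in_itv /= => u01.
  by have [_ _ mu'] := Hg u; rewrite (mixture2_Rintegral hX u01 (mu' u01) cphi).
- by exists 0; [rewrite /= in_itv /= lexx ler01|have [->] := Hg 0].
- by exists 1; [rewrite /= in_itv /= lexx ler01|have [_ ->] := Hg 1].
- move=> _ [t + <-]; rewrite /= in_itv /= => t01; have [_ _ /(_ t01) mt] := Hg t.
  have [nu' Hnu'] := mixture2_ex mu nu t01.
  exists nu'; first exact: (mixture2_invariant Hnu' imu inu).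
  by move=> A mA; rewrite (mt A mA) (mix A mA) (Hnu' A mA); ring.
Qed.

Lemma homothety_connected : connected homothety.
Proof.
have hC (lam : borel_prob X) : exists C : set (borel_prob X), homothety lam ->
    [/\ connected C, C mu, C lam & C `<=` homothety].
  have [/homothety_segment[C HC]|nK] := pselect (homothety lam); last by exists set0.
  by exists C.
have [C HC] := choice hC.
have -> : homothety = \bigcup_(lam in homothety) C lam.
  apply/seteqP; split=> [lam Klam|lam' [lam Klam]].
    by exists lam => //; have [] := HC lam Klam.
  by have [_ _ _] := HC lam Klam; apply.
apply: bigcup_connected.
  by exists mu => lam Klam; have [] := HC lam Klam.
by move=> lam Klam; have [] := HC lam Klam.
Qed.

End Homothety.

(** * Pressure of intersections of irregular sets *)

Theorem theoremB (R : realType) (X : pointedMetricType R) (f : X -> X)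
    (hX : compact [set: X]) (hf : continuous f)
    (hsat : sequentially_saturated f)
    (hne : irregular_sequence f !=set0)
    (D : set (nat -> X -> R)) (hD : D `<=` irregular_sequence f)
    (Phi : nat -> X -> R) (hPhi : asymptotically_additive f Phi) :
  pressure f (\bigcap_(Psi in D) irregular_set Psi) Phi =
  pressure f [set: X] Phi.
Proof.
apply: le_anti; apply/andP; split; first exact: (pressure_setS hX hPhi (@subsetT _ _)).
rewrite leNgt; apply/negP => lt.
have [c [lc cP]] : exists c : R,
    (pressure f (\bigcap_(Psi in D) irregular_set Psi) Phi < c%:E)%E /\
    (c%:E < pressure f [set: X] Phi)%E.
  move: lt; set a := pressure f _ Phi; set b := pressure f setT Phi.
  case: a b => [a| |] [b| |] //; rewrite ?lte_fin.
  - by move=> ab; exists ((a + b) / 2); rewrite !lte_fin; split; lra.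
  - by move=> _; exists (a + 1); rewrite lte_fin ltry; split => //; lra.
  - by move=> _; exists (b - 1); rewrite lte_fin ltNyr; split => //; lra.
  - by move=> _; exists 0; rewrite ltNyr ltry.
have [mu [k [xi [h [imu mxi hE ch]]]]] := variational_bound hX hf hPhi cP.
have [B HB] := mean_value_bounded hX hf hPhi.
(* With this th, (1 - th) * (h + mean_value Phi mu) - th * B >= c. The absolute
   value of a keeps th in (0, 1] whatever the sign of a. *)
pose s := h + mean_value Phi mu - c; pose a := h + mean_value Phi mu + B.
have s0 : 0 < s by rewrite /s; lra.
have as0 : 0 < `|a| + s by rewrite ltr_wpDl.
pose th := s / (`|a| + s).
have th0 : 0 < th by rewrite divr_gt0.
have th1 : th <= 1 by rewrite ler_pdivrMr // mul1r lerDr.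
have th01 : 0 <= th <= 1 by rewrite ltW.
have tha : th * a <= s.
  rewrite /th mulrAC ler_pdivrMr // ler_pM2l //.
  by apply: le_trans (ler_norm _) _; rewrite lerDl ltW.
pose K := homothety f mu th.
have Kmu : K mu by exact: homothety_center.
have Kinv : K `<=` @invariant_measures R X f by exact: homothety_invariant.
have Kclosed : borel_closed K by exact: homothety_borel_closed.
have Kcompact : compact K by exact: homothety_compact.
have Kconnected : connected K by exact: homothety_connected.
have := hsat Phi K hPhi Kclosed Kinv (ex_intro _ _ Kmu) Kcompact Kconnected.
set I := ereal_inf _ => PK.
have cI : (c%:E <= I)%E.
  apply: le_ereal_inf_tmp => _ [lam Klam <-].
  have ilam := Kinv _ Klam.
  have [nu inu mix] := Klam.
  have h1 : (((1 - th) * h)%:E <= measure_entropy f lam)%E.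
    apply: le_trans (entropy_of_partition_mixture hf th01 imu ilam mix mxi hE) _.
    by apply: ereal_sup_ubound; exists k, xi.
  apply: le_trans (leeD2r _ h1); rewrite -EFinD lee_fin.
  rewrite (mean_value_mixture hX hf hPhi th01 imu inu ilam mix).
  have := HB nu inu; rewrite ler_norml => /andP[nuB _].
  have h2 : th * - B <= th * mean_value Phi nu by rewrite ler_pM2l.
  move: tha h2; rewrite /a /s; set m := mean_value Phi mu; set m' := mean_value Phi nu.
  move: (th * m') => p; rewrite mulrDl mulrDr; lra.
(* A point of the saturated set has mu and lam as limit measures, and Psi has
   different mean values at mu and lam. *)
have sub : saturated_set f K `<=` \bigcap_(Psi in D) irregular_set Psi.
  move=> x satx Psi /hD irr /cvg_ex[l cl].
  have [aPsi _] := irr.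
  have [nu inu ne] := irregular_mean_value hX hf (mean_value Psi mu) irr.
  have [lam mix] := mixture2_ex mu nu th01.
  have Klam : K lam by exists nu.
  have ilam := Kinv _ Klam.
  have e1 := saturated_mean_value hX hf aPsi Kmu imu satx cl.
  have e2 := saturated_mean_value hX hf aPsi Klam ilam satx cl.
  apply: ne; move: e2; rewrite (mean_value_mixture hX hf aPsi th01 imu inu ilam mix) -e1.
  move/eqP; rewrite -subr_eq0 (_ : _ - _ = th * (mean_value Psi nu - mean_value Psi mu)).
    by rewrite mulf_eq0 (gt_eqF th0) subr_eq0 => /eqP.
  ring.
have := pressure_setS hX hPhi sub; rewrite PK => /(le_trans cI).
by rewrite leNgt lc.
Qed.
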